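(* Bounded C2C \textsc{Nondeterministic Constraint Logic}, parameterized by the solution length $l$, is fixed-parameter tractable and can be solved in time $O^*(2^l)$ (where $O^*$ suppresses factors polynomial in the input size).
   Context: A constraint graph is an undirected graph with a positive integer weight on every edge and a nonnegative integer weight (its minimum inflow) on every vertex. A legal configuration is an assignment of an orientation to every edge such that for every vertex, the total weight of the edges oriented into that vertex is at least that vertex's minimum inflow. A reconfiguration sequence is a sequence of legal configurations in which each configuration is obtained from the previous one by reversing exactly one edge; its length is the number of edge reversals; it is bounded if every edge is reversed at most once. Bounded C2C NCL parameterized by solution length: given a constraint graph $G$, legal configurations $C_1,C_2$ and an integer $l$, is there a bounded reconfiguration sequence from $C_1$ to $C_2$ of length at most $l$? *)

(* Defs.v *)
From mathcomp Require Export all_boot.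

Set Implicit Arguments.
Unset Strict Implicit.
Unset Printing Implicit Defensive.

(** * Random access machines

  The RAM of Cook and Reckhow (Time bounded random access machines, 1973) with
  uniform cost: registers X_0, X_1, ... hold natural numbers (initially 0), the
  input is a read-only sequence of natural numbers.  The only arithmetic is
  addition and truncated subtraction, so that the unit-cost measure is
  polynomially related to Turing machine time. *)

Inductive instr : Type :=
| IConst of nat & nat          (* IConst i c : X_i <- c *)
| IAdd of nat & nat & nat      (* IAdd i j k : X_i <- X_j + X_k *)
| ISub of nat & nat & nat      (* ISub i j k : X_i <- X_j - X_k, truncated *)
| ILoad of nat & nat           (* ILoad i j  : X_i <- X_(X_j) *)
| IStore of nat & nat          (* IStore i j : X_(X_i) <- X_j *)
| IJpos of nat & nat           (* IJpos j m  : go to instruction m if X_j > 0 *)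
| IRead of nat.                (* IRead i    : X_i <- next input, 0 if none left *)

Definition program := seq instr.

Record state := State { pc : nat; reg : nat -> nat; input : seq nat }.

Definition upd (X : nat -> nat) (i x : nat) : nat -> nat :=
  fun j => if j == i then x else X j.

Definition exec (ins : instr) (s : state) : state :=
  let: State p X inp := s in
  match ins with
  | IConst i c => State p.+1 (upd X i c) inp
  | IAdd i j k => State p.+1 (upd X i (X j + X k)) inp
  | ISub i j k => State p.+1 (upd X i (X j - X k)) inp
  | ILoad i j => State p.+1 (upd X i (X (X j))) inp
  | IStore i j => State p.+1 (upd X (X i) (X j)) inp
  | IJpos j m => State (if 0 < X j then m else p.+1) X inp
  | IRead i => State p.+1 (upd X i (head 0 inp)) (behead inp)
  end.

Definition ram_step (M : program) (s : state) : state :=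
  if onth M (pc s) is Some ins then exec ins s else s.

Definition halted (M : program) (s : state) : bool := size M <= pc s.

Definition init (inp : seq nat) : state := State 0 (fun _ => 0) inp.

(* M halts on inp after at most t steps, with output y in X_0. *)
Definition outputs_within (M : program) (inp : seq nat) (t y : nat) : Prop :=
  let s := iter t (ram_step M) (init inp) in halted M s /\ reg s 0 = y.

Definition computable (f : nat -> nat) : Prop :=
  exists M : program, forall n, exists t, outputs_within M [:: n] t (f n).

(** * Parameterized problems *)

Record param_problem := ParamProblem {
  instance : Type;
  encoding : instance -> seq nat;
  parameter : instance -> nat;
  yes : instance -> Prop
}.

(* Length of the binary numeral of x (1 for x = 0). *)
Definition bitlen (x : nat) : nat := (trunc_log 2 x).+1.

Definition input_size (P : param_problem) (x : instance P) : nat :=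
  \sum_(a <- encoding x) bitlen a.

Definition decides_within (P : param_problem) (M : program)
    (T : instance P -> nat) : Prop :=
  forall x : instance P,
    (yes x -> outputs_within M (encoding x) (T x) 1) /\
    (~ yes x -> outputs_within M (encoding x) (T x) 0).

(* P can be solved in time O^*(f(k)), where k is the parameter. *)
Definition solvable_in_Ostar (P : param_problem) (f : nat -> nat) : Prop :=
  exists (M : program) (c d : nat),
    decides_within M
      (fun x : instance P => c * f (parameter x) * input_size x ^ d).

Definition fixed_parameter_tractable (P : param_problem) : Prop :=
  exists2 f : nat -> nat, computable f & solvable_in_Ostar P f.

(** * Nondeterministic Constraint Logic *)

(* The values of [weight] on non-adjacent pairs are irrelevant. *)
Record cgraph := CGraph {
  nv : nat;
  adj : rel 'I_nv;
  weight : 'I_nv -> 'I_nv -> nat;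
  min_inflow : 'I_nv -> nat;
  adj_sym : symmetric adj;
  adj_irr : irreflexive adj;
  weight_sym : forall u v, weight u v = weight v u;
  weight_pos : forall u v, adj u v -> 0 < weight u v
}.

(* A configuration is given by its set of arcs: (u, v) \in C means that the
   edge uv is oriented from u to v. *)
Definition config (G : cgraph) := {set 'I_(nv G) * 'I_(nv G)}.

Definition orientation (G : cgraph) (C : config G) : Prop :=
  (forall u v, (u, v) \in C -> adj u v) /\
  (forall u v, adj u v -> ((u, v) \in C) = ((v, u) \notin C)).

Definition inflow (G : cgraph) (C : config G) (v : 'I_(nv G)) : nat :=
  \sum_(u | (u, v) \in C) weight u v.

Definition legal (G : cgraph) (C : config G) : Prop :=
  orientation C /\ forall v, min_inflow v <= inflow C v.

Definition reverse (G : cgraph) (C : config G) (u v : 'I_(nv G)) : config G :=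
  (v, u) |: (C :\ (u, v)).

(* C' is obtained from C by reversing the edge uv (and nothing else). *)
Definition reverses (G : cgraph) (u v : 'I_(nv G)) (C C' : config G) : bool :=
  ((u, v) \in C) && (C' == reverse C u v) ||
  ((v, u) \in C) && (C' == reverse C v u).

Definition reversal (G : cgraph) (C C' : config G) : bool :=
  [exists u, exists v, reverses u v C C'].

(* The sequence of configurations is C1 :: s; its length is size s. *)
Definition reconf_seq (G : cgraph) (C1 C2 : config G) (s : seq (config G)) :
    Prop :=
  [/\ forall C, C \in C1 :: s -> legal C,
      path (@reversal G) C1 s
    & last C1 s = C2].

Definition times_reversed (G : cgraph) (C1 : config G) (s : seq (config G))
    (u v : 'I_(nv G)) : nat :=
  count (fun CC => reverses u v CC.1 CC.2) (zip (C1 :: s) s).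

Definition bounded (G : cgraph) (C1 : config G) (s : seq (config G)) : Prop :=
  forall u v, adj u v -> times_reversed C1 s u v <= 1.

Record ncl_instance := NCLInstance {
  ncl_graph : cgraph;
  ncl_start : config ncl_graph;
  ncl_target : config ncl_graph;
  ncl_length : nat;
  ncl_start_legal : legal ncl_start;
  ncl_target_legal : legal ncl_target
}.

Definition ncl_yes (x : ncl_instance) : Prop :=
  exists s : seq (config (ncl_graph x)),
    [/\ reconf_seq (ncl_start x) (ncl_target x) s,
        bounded (ncl_start x) s
      & size s <= ncl_length x].

Definition matrix_enc (n : nat) (A : 'I_n -> 'I_n -> nat) : seq nat :=
  [seq A u v | u <- enum 'I_n, v <- enum 'I_n].

Definition config_enc (G : cgraph) (C : config G) : seq nat :=
  matrix_enc (fun u v => nat_of_bool ((u, v) \in C)).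

(* Number of vertices, weighted adjacency matrix (0 for a non-edge), minimum
   inflows, the two orientations as 0/1 matrices, and the length bound. *)
Definition ncl_enc (x : ncl_instance) : seq nat :=
  let G := ncl_graph x in
  nv G
  :: matrix_enc (fun u v : 'I_(nv G) => if adj u v then weight u v else 0)
  ++ [seq min_inflow v | v <- enum 'I_(nv G)]
  ++ config_enc (ncl_start x)
  ++ config_enc (ncl_target x)
  ++ [:: ncl_length x].

Definition bounded_C2C_NCL : param_problem :=
  @ParamProblem ncl_instance ncl_enc ncl_length ncl_yes.

(* Main.v *)
Require Import Defs.
From mathcomp Require Import all_boot zify.

(** A bounded sequence from C1 to C2 reverses each arc of D = C1 \ C2 exactly
  once and no other edge, so it is an ordering of D all of whose prefixes give
  legal configurations, and its length is |D|.  If |D| > l the answer is no.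
  Otherwise, dynamic programming over the 2^|D| subsets of D (bit masks, in
  increasing order) decides it: a subset is reachable iff its configuration is
  legal and it is empty or stays reachable after removing one of its arcs.

  The random access machine is obtained by compiling a small structured language
  whose loops have a count fixed on entry, so that both the result and the
  running time of a command are total functions of the store. *)

Set Implicit Arguments.
Unset Strict Implicit.
Unset Printing Implicit Defensive.

(** * A structured language *)

(** Boundedness is what makes a subset a sufficient state: an edge reversed once never turns back,
    so the configuration depends only on the set of arcs reversed so far, and the target forces the
    final set to be D. Reversing an arc moves its weight from its head to its tail; writing the
    inflow condition as minimum plus lost weight at most initial inflow plus gained weight needs
    only addition and comparison. The machine has neither multiplication nor division, so squares
    and powers come from repeated addition, and the bits of a mask are split off from the top by
    comparing a remainder with tabulated powers of two. Removing an arc subtracts a power of two and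
    lands on a smaller mask, which is why one increasing pass suffices. For |D| > l the number of
    masks is set to 0, which keeps the exponential factor at 2^l on every input; the work per mask
    is linear in n and |D|. *)

Record store := Store {
  var : nat -> nat;
  arr : nat -> nat -> nat;
  inp : seq nat
}.

Definition setv (s : store) (x n : nat) : store :=
  Store (upd (var s) x n) (arr s) (inp s).

Definition seta (s : store) (a i n : nat) : store :=
  Store (var s) (fun b => if b == a then upd (arr s a) i n else arr s b) (inp s).

Inductive cmd : Type :=
| Skip
| Const of nat & nat
| Add of nat & nat & nat
| Sub of nat & nat & nat
| Get of nat & nat & nat
| Put of nat & nat & nat
| Read of nat
| Seq of cmd & cmd
| If of nat & cmd & cmd
| Loop of nat & cmd.

Declare Scope cmd_scope.
Delimit Scope cmd_scope with cmd.
Bind Scope cmd_scope with cmd.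
Notation "c1 ;; c2" := (Seq c1 c2) (at level 90, right associativity) : cmd_scope.

Fixpoint eval (c : cmd) (s : store) : store :=
  match c with
  | Skip => s
  | Const x n => setv s x n
  | Add x y z => setv s x (var s y + var s z)
  | Sub x y z => setv s x (var s y - var s z)
  | Get x a y => setv s x (arr s a (var s y))
  | Put a y x => seta s a (var s y) (var s x)
  | Read x => Store (upd (var s) x (head 0 (inp s))) (arr s) (behead (inp s))
  | Seq c1 c2 => eval c2 (eval c1 s)
  | If x c1 c2 => if 0 < var s x then eval c1 s else eval c2 s
  | Loop x c1 => iter (var s x) (eval c1) s
  end.

(** Exact step counts of the compiled code. An iteration pays 3 for test, constant and decrement; a
    loop pays 5 for four set-up instructions and the failing last test; an else branch pays 3 for
    the test and the two-instruction jump over the other branch. *)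
Fixpoint time (c : cmd) (s : store) : nat :=
  match c with
  | Skip => 0
  | Const _ _ | Add _ _ _ | Sub _ _ _ | Read _ => 1
  | Get _ _ _ | Put _ _ _ => 7
  | Seq c1 c2 => time c1 s + time c2 (eval c1 s)
  | If x c1 c2 => if 0 < var s x then (time c1 s).+1 else (time c2 s).+3
  | Loop x c1 =>
      \sum_(i < var s x) (time c1 (iter i (eval c1) s) + 3) + 5
  end.

(** * Compilation *)

(* Registers below 32 hold the variables, 32 + d is the counter of a loop at
   nesting depth d, 48 and 49 are scratch, and cell i of array a is register
   16 * i + (64 + a): interleaving lets all arrays be unbounded. *)

Definition addr_code (a y : nat) : program :=
  [:: IAdd 48 y y; IAdd 48 48 48; IAdd 48 48 48; IAdd 48 48 48;
      IConst 49 (64 + a); IAdd 48 48 49].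

Fixpoint csize (c : cmd) : nat :=
  match c with
  | Skip => 0
  | Const _ _ | Add _ _ _ | Sub _ _ _ | Read _ => 1
  | Get _ _ _ | Put _ _ _ => 7
  | Seq c1 c2 => csize c1 + csize c2
  | If _ c1 c2 => csize c1 + csize c2 + 3
  | Loop _ c1 => csize c1 + 7
  end.

(** Jump targets are absolute, hence the start address [p]. The only jump is conditional, so an
    unconditional one first sets register 48 to 1. A loop is entered at its test, placed after the
    body, and counts down a copy of [x], so the body may overwrite [x]. *)
Fixpoint compile (c : cmd) (d p : nat) : program :=
  match c with
  | Skip => [::]
  | Const x n => [:: IConst x n]
  | Add x y z => [:: IAdd x y z]
  | Sub x y z => [:: ISub x y z]
  | Get x a y => addr_code a y ++ [:: ILoad x 48]
  | Put a y x => addr_code a y ++ [:: IStore 48 x]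
  | Read x => [:: IRead x]
  | Seq c1 c2 => compile c1 d p ++ compile c2 d (p + csize c1)
  | If x c1 c2 =>
      IJpos x (p + csize c2 + 3) :: compile c2 d p.+1
      ++ [:: IConst 48 1; IJpos 48 (p + csize c2 + 3 + csize c1)]
      ++ compile c1 d (p + csize c2 + 3)
  | Loop x c1 =>
      [:: IConst 49 0; IAdd (32 + d) x 49; IConst 48 1;
          IJpos 48 (p + 6 + csize c1);
          IConst 48 1; ISub (32 + d) (32 + d) 48]
      ++ compile c1 d.+1 (p + 6) ++ [:: IJpos (32 + d) (p + 4)]
  end.

Fixpoint wf (c : cmd) (d : nat) : bool :=
  match c with
  | Skip => true
  | Const x _ | Read x => x < 32
  | Add x y z | Sub x y z => [&& x < 32, y < 32 & z < 32]
  | Get x a y | Put a y x => [&& x < 32, a < 16 & y < 32]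
  | Seq c1 c2 => wf c1 d && wf c2 d
  | If x c1 c2 => [&& x < 32, wf c1 d & wf c2 d]
  | Loop x c1 => [&& x < 32, d < 16 & wf c1 d.+1]
  end.

Fixpoint code_at (M : program) (p : nat) (l : program) : Prop :=
  if l is ins :: l' then onth M p = Some ins /\ code_at M p.+1 l' else True.

Local Arguments onth : simpl never.

Lemma code_at_cat M p l1 l2 :
  code_at M p (l1 ++ l2) <-> code_at M p l1 /\ code_at M (p + size l1) l2.
Proof.
elim: l1 p => [|i l1 IH] p /=; first by rewrite addn0; tauto.
by rewrite IH addnS; tauto.
Qed.

Lemma code_at_self M l : code_at (l ++ M) (size l) M.
Proof.
elim: M l => [|i M IH] l //=; split.
  by rewrite onth_cat ltnn subnn.
by have := IH (rcons l i); rewrite cat_rcons size_rcons.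
Qed.

Lemma size_compile c d p : size (compile c d p) = csize c.
Proof.
elim: c d p => //= [c1 IH1 c2 IH2|x c1 IH1 c2 IH2|x c1 IH1] d p;
  by rewrite !size_cat /= ?IH1 ?IH2 //=; lia.
Qed.

Definition agree (X : nat -> nat) (s : store) : Prop :=
  (forall x, x < 32 -> X x = var s x) /\
  (forall a i, a < 16 -> X (16 * i + (64 + a)) = arr s a i).

Lemma agree_upd_scratch X s r n :
  32 <= r < 64 -> agree X s -> agree (upd X r n) s.
Proof.
move=> hr [hv ha]; split=> [x hx|a i hi]; rewrite /upd; case: eqP => [|_]; try lia.
  exact: hv.
exact: ha.
Qed.

Lemma agree_setv X s x n : x < 32 -> agree X s -> agree (upd X x n) (setv s x n).
Proof.
move=> hr [hv ha]; split=> [y hy|a i hi]; rewrite /upd /= /upd.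
  by case: eqP => // _; apply: hv.
by case: eqP => [|_]; [lia | apply: ha].
Qed.

Lemma agree_seta X s a i n :
  a < 16 -> agree X s -> agree (upd X (16 * i + (64 + a)) n) (seta s a i n).
Proof.
move=> hr [hv ha]; split=> [y hy|b j hb]; rewrite /upd /= /upd.
  by case: eqP => [|_]; [lia | apply: hv].
case: (eqVneq b a) => [->|hab].
  case: (eqVneq j i) => [->|hij]; first by rewrite eqxx.
  by case: eqP => [|_]; [lia | apply: ha].
by case: eqP => [|_]; [lia | apply: ha].
Qed.

Lemma stepE M p X i ins : onth M p = Some ins ->
  ram_step M (State p X i) = exec ins (State p X i).
Proof. by rewrite /ram_step /= => ->. Qed.

(** The last clause protects the counters of the enclosing loops, which [agree] does not see. *)
Definition simulates (M : program) (d t : nat) (c : cmd) (p : nat)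
    (X : nat -> nat) (s : store) : Prop :=
  exists X', [/\ iter t (ram_step M) (State p X (inp s)) =
                 State (p + csize c) X' (inp (eval c s)),
               agree X' (eval c s)
             & forall j, j < d -> X' (32 + j) = X (32 + j)].

Lemma addr_code_run M p X i a y : y < 32 -> code_at M p (addr_code a y) ->
  exists2 X', iter 6 (ram_step M) (State p X i) = State (p + 6) X' i
   & X' 48 = 16 * X y + (64 + a) /\ forall j, j != 48 -> j != 49 -> X' j = X j.
Proof.
move=> hy [h1 [h2 [h3 [h4 [h5 [h6 _]]]]]].
rewrite /= (stepE _ _ h1) /= (stepE _ _ h2) /= (stepE _ _ h3) /= (stepE _ _ h4) /=.
rewrite (stepE _ _ h5) /= (stepE _ _ h6) /=.
eexists; first by rewrite !addnS addn0.
rewrite /upd /=; split; first by lia.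
by move=> j /negPf -> /negPf ->.
Qed.

Lemma compile_correct M c d p X s :
  d <= 16 -> code_at M p (compile c d p) -> wf c d -> agree X s ->
  simulates M d (time c s) c p X s.
Proof.
elim: c d p X s => [|x n|x y z|x y z|x a y|a y x|x|c1 IH1 c2 IH2
  |x c1 IH1 c2 IH2|x c1 IH1] d p X s hd16.
- by move=> _ _ hs; exists X; rewrite /= addn0.
- case=> h _ /= hx hs; exists (upd X x n); rewrite /= (stepE _ _ h) addn1; split=> //.
    exact: agree_setv.
  by move=> j hj; rewrite /upd; case: eqP => //; lia.
- case=> h _ /= /and3P[hx hy hz] hs; case: (hs) => hv _.
  exists (upd X x (X y + X z)); rewrite /= (stepE _ _ h) addn1; split=> //.
    by rewrite !hv //; apply: agree_setv.
  by move=> j hj; rewrite /upd; case: eqP => //; lia.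
- case=> h _ /= /and3P[hx hy hz] hs; case: (hs) => hv _.
  exists (upd X x (X y - X z)); rewrite /= (stepE _ _ h) addn1; split=> //.
    by rewrite !hv //; apply: agree_setv.
  by move=> j hj; rewrite /upd; case: eqP => //; lia.
- case/code_at_cat=> hA [h _] /and3P[hx ha hy] hs; case: (hs) => hv hr.
  have [X1 e1 [e48 e2]] := addr_code_run X (inp s) hy hA.
  exists (upd X1 x (X1 (X1 48))); split.
  + rewrite /time (iterD 1 6) e1 /= (stepE _ _ h) /=; congr State; lia.
  + rewrite e48 hv // [X1 (_ + _)]e2 ?hr //=; try lia.
    apply: agree_setv => //.
    split=> [z hz|b i hb]; rewrite e2; try lia; [exact: hv|exact: hr].
  + by move=> j hj; rewrite /upd; case: eqP => [|_]; [lia | apply: e2; lia].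
- case/code_at_cat=> hA [h _] /and3P[hx ha hy] hs; case: (hs) => hv hr.
  have [X1 e1 [e48 e2]] := addr_code_run X (inp s) hy hA.
  exists (upd X1 (X1 48) (X1 x)); split.
  + rewrite /time (iterD 1 6) e1 /= (stepE _ _ h) /=; congr State; lia.
  + rewrite e48 [X1 x]e2 ?hv //=; try lia.
    apply: agree_seta => //.
    split=> [z hz|b i hb]; rewrite e2; try lia; [exact: hv|exact: hr].
  + move=> j hj; rewrite e48 /upd; case: eqP => [|_]; [lia | apply: e2; lia].
- case=> h _ /= hx hs; exists (upd X x (head 0 (inp s))).
  rewrite /= (stepE _ _ h) addn1; split=> //.
    by have [? ?] := agree_setv (head 0 (inp s)) hx hs.
  by move=> j hj; rewrite /upd; case: eqP => //; lia.
- case/code_at_cat=> h1; rewrite size_compile => h2 /andP[w1 w2] hs.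
  have [X1 [e1 a1 k1]] := IH1 _ _ _ _ hd16 h1 w1 hs.
  have [X2 [e2 a2 k2]] := IH2 _ _ _ _ hd16 h2 w2 a1.
  exists X2; split=> //.
    by rewrite /= addnC iterD e1 e2 addnA.
  by move=> j hj; rewrite k2 ?k1.
- case=> h /code_at_cat[h2]; rewrite size_compile => -[hc [hj h1]] /and3P[hx w1 w2] hs.
  have hxv : X x = var s x by case: hs => hv _; apply: hv.
  have e0 := stepE X (inp s) h; rewrite /= hxv in e0.
  rewrite /simulates /=; case: ifP e0 => hpos e0.
    have h1' : code_at M (p + csize c2 + 3) (compile c1 d (p + csize c2 + 3)).
      by move: h1; congr (code_at M _ _); lia.
    have [X1 [e1 a1 k1]] := IH1 _ _ _ _ hd16 h1' w1 hs.
    exists X1; split=> //; rewrite iterSr e0 e1; congr State; lia.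
  have [X1 [e1 a1 k1]] := IH2 _ _ _ _ hd16 h2 w2 hs.
  exists (upd X1 48 1); split.
  + rewrite (_ : _.+3 = 2 + (time c2 s + 1)); last by lia.
    rewrite (iterD 2) iterD /= e0 e1 (stepE _ _ hc) /= (stepE _ _ hj) /=.
    congr State; lia.
  + exact: agree_upd_scratch.
  + by move=> j hj'; rewrite /upd; case: eqP => [|_]; [lia | apply: k1].
- case=> h0 [h1 [h2 [h3 [h4 [h5]]]]] /code_at_cat[hc]; rewrite size_compile => -[ht _].
  move=> /and3P[hx hd w] hs.
  have hxv : X x = var s x by case: hs => hv _; apply: hv.
  have hc' : code_at M (p + 6) (compile c1 d.+1 (p + 6)).
    by move: hc; congr (code_at M _ _); lia.
  have ht' : onth M (p + 6 + csize c1) = Some (IJpos (32 + d) (p + 4)).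
    by rewrite -ht; congr (onth M _); lia.
  have h4' : onth M (p + 4) = Some (IConst 48 1) by rewrite -h4; congr (onth M _); lia.
  have h5' : onth M (p + 5) = Some (ISub (32 + d) (32 + d) 48)
    by rewrite -h5; congr (onth M _); lia.
  (* The invariant is taken at the test below the body, after [m] iterations; the summand 4 is the
     set-up code, and the failing last test is added at the end. *)
  have loop m : m <= var s x -> exists X', [/\
      iter (\sum_(i < m) (time c1 (iter i (eval c1) s) + 3) + 4) (ram_step M)
        (State p X (inp s)) = State (p + 6 + csize c1) X' (inp (iter m (eval c1) s)),
      agree X' (iter m (eval c1) s), X' (32 + d) = var s x - m
    & forall j, j < d -> X' (32 + j) = X (32 + j)].
    elim: m => [|m IHm] hm.
      exists (upd (upd (upd X 49 0) (32 + d) (X x)) 48 1); split.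
      + rewrite big_ord0 /= (stepE _ _ h0) /= (stepE _ _ h1) /=.
        rewrite (stepE _ _ h2) /= (stepE _ _ h3) /=.
        rewrite /upd /= addn0; congr State.
        by case: (eqVneq x 49) => //; lia.
      + by do !apply: agree_upd_scratch => //; lia.
      + rewrite /upd eqxx; case: eqP => [|_]; lia.
      + move=> j hj; rewrite /upd; do !(case: eqP => [|_]; first by lia); done.
    have [|X1 [e1 a1 c1d k1]] := IHm; first by lia.
    set X2 := upd (upd X1 48 1) (32 + d) (X1 (32 + d) - 1).
    have a2 : agree X2 (iter m (eval c1) s) by do !apply: agree_upd_scratch => //; lia.
    have [X3 [e3 a3 k3]] := IH1 _ _ _ _ hd hc' w a2.
    exists X3; split=> //.
    + rewrite big_ord_recr /=.
      rewrite (_ : _ + 4 = time c1 (iter m (eval c1) s) +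
        (3 + (\sum_(i < m) (time c1 (iter i (eval c1) s) + 3) + 4)));
        last by rewrite [X in X + 4]addnC -!addnA.
      rewrite iterD (iterD 3) e1 /= (stepE _ _ ht') /= c1d subn_gt0 hm.
      rewrite (stepE _ _ h4') /= -addnS (stepE _ _ h5') /= -addnS.
      rewrite -[RHS]e3; congr iter; congr State.
      rewrite /X2 /upd (_ : (32 + d == 48) = false) //=; lia.
    + rewrite k3 // /X2 /upd eqxx c1d; lia.
    + move=> j hj; rewrite k3; last by lia.
      rewrite /X2 /upd; do 2 (case: eqP => [|_]; first by lia).
      exact: k1.
  have [//|X1 [e1 a1 c1d k1]] := loop (var s x).
  exists X1; split=> //.
  rewrite /time -/time (addnA _ 4 1) addnC iterD e1 /= (stepE _ _ ht') /=.
  rewrite c1d subnn /=; congr State; lia.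
Qed.

Definition start_store (l : seq nat) : store :=
  Store (fun _ => 0) (fun _ _ => 0) l.

Lemma compile_outputs c l t :
  wf c 0 -> time c (start_store l) <= t ->
  outputs_within (compile c 0 0) l t
    (var (eval c (start_store l)) 0).
Proof.
move=> w ht; set s := start_store l in ht *.
have [//|X' [e [hv _] _]] := @compile_correct (compile c 0 0) c 0 0 (fun _ => 0) s
  isT (code_at_self _ [::]) w.
rewrite /outputs_within.
(* Past the end of the code [ram_step] is the identity, so the steps left over until [t] change
   nothing. *)
have -> : iter t (ram_step (compile c 0 0)) (init l) =
          State (csize c) X' (inp (eval c s)).
  rewrite -(subnK ht) iterD e add0n; elim: (t - _) => //= m ->.
  by rewrite /ram_step /= onth_default ?size_compile.
by rewrite /halted /= size_compile hv.
Qed.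

(** * Frame and running time *)

Fixpoint wvars (c : cmd) : seq nat :=
  match c with
  | Skip | Put _ _ _ => [::]
  | Const x _ | Add x _ _ | Sub x _ _ | Get x _ _ | Read x => [:: x]
  | Seq c1 c2 | If _ c1 c2 => wvars c1 ++ wvars c2
  | Loop _ c1 => wvars c1
  end.

Fixpoint warrs (c : cmd) : seq nat :=
  match c with
  | Put a _ _ => [:: a]
  | Seq c1 c2 | If _ c1 c2 => warrs c1 ++ warrs c2
  | Loop _ c1 => warrs c1
  | _ => [::]
  end.

Fixpoint lvars (c : cmd) : seq nat :=
  match c with
  | Seq c1 c2 | If _ c1 c2 => lvars c1 ++ lvars c2
  | Loop x c1 => x :: lvars c1
  | _ => [::]
  end.

Lemma eval_frame_var c x s : x \notin wvars c -> var (eval c s) x = var s x.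
Proof.
elim: c s => //= [y ?|y ? ?|y ? ?|y ? ?|y|c1 IH1 c2 IH2|y c1 IH1 c2 IH2|y c1 IH1] s;
  rewrite ?inE ?mem_cat ?negb_or /upd; try by move/negPf->.
- by case/andP=> h1 h2; rewrite IH2 // IH1.
- by case/andP=> h1 h2; case: ifP => _; [apply: IH1 | apply: IH2].
- by move=> h; elim: (var s y) => //= m <-; apply: IH1.
Qed.

Lemma eval_frame_arr c a s : a \notin warrs c -> arr (eval c s) a = arr s a.
Proof.
elim: c s => //= [b ? ?|c1 IH1 c2 IH2|y c1 IH1 c2 IH2|y c1 IH1] s;
  rewrite ?inE ?mem_cat ?negb_or; try by move/negPf->.
- by case/andP=> h1 h2; rewrite IH2 // IH1.
- by case/andP=> h1 h2; case: ifP => _; [apply: IH1 | apply: IH2].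
- by move=> h; elim: (var s y) => //= m <-; apply: IH1.
Qed.

Fixpoint time_bound (c : cmd) (E : nat -> nat) : nat :=
  match c with
  | Skip => 0
  | Const _ _ | Add _ _ _ | Sub _ _ _ | Read _ => 1
  | Get _ _ _ | Put _ _ _ => 7
  | Seq c1 c2 => time_bound c1 E + time_bound c2 E
  | If _ c1 c2 => time_bound c1 E + time_bound c2 E + 3
  | Loop x c1 => E x * (time_bound c1 E + 3) + 5
  end.

(** A fixed list [L] instead of [lvars c] survives the passage to subcommands: in a sequence, the
    first part must not overwrite the loop counts of the second either. *)
Lemma time_le_bound_in (L : seq nat) c s E :
  all [in L] (lvars c) -> ~~ has [in L] (wvars c) ->
  (forall x, x \in L -> var s x = E x) -> time c s <= time_bound c E.
Proof.
have frame c' s' x : ~~ has [in L] (wvars c') -> x \in L -> var (eval c' s') x = var s' x.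
  move=> hw hx; apply: eval_frame_var; apply: contra hw => hx'.
  by apply/hasP; exists x.
elim: c s => //= [c1 IH1 c2 IH2|y c1 IH1 c2 IH2|y c1 IH1] s.
- rewrite all_cat has_cat negb_or => /andP[l1 l2] /andP[w1 w2] hE.
  apply: leq_add; first exact: IH1.
  by apply: IH2 => // x hx; rewrite frame // hE.
- rewrite all_cat has_cat negb_or => /andP[l1 l2] /andP[w1 w2] hE.
  by have := IH1 _ l1 w1 hE; have := IH2 _ l2 w2 hE; case: ifP; lia.
- case/andP=> ly l1 w1 hE; rewrite leq_add2r -hE //.
  rewrite -[var s y in X in _ <= X]card_ord -sum_nat_const.
  apply: leq_sum => i _; rewrite leq_add2r; apply: IH1 => // x hx.
  rewrite -hE //; elim: {i}(i : nat) => //= m <-; exact: frame.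
Qed.

(** For a concrete command the side condition is settled by computation, and the bound unfolds to a
    polynomial in the loop counts. A command that computes its own loop counts violates it, so the
    solver is timed piece by piece. *)
Lemma time_le_bound c s :
  ~~ has [in lvars c] (wvars c) -> time c s <= time_bound c (var s).
Proof.
move=> h; apply: (time_le_bound_in (L := lvars c)) => //.
Qed.

Lemma eval_seq c1 c2 s : eval (c1 ;; c2)%cmd s = eval c2 (eval c1 s).
Proof. by []. Qed.

Lemma time_seq c1 c2 s : time (c1 ;; c2)%cmd s = time c1 s + time c2 (eval c1 s).
Proof. by []. Qed.

Fixpoint no_read (c : cmd) : bool :=
  match c with
  | Read _ => false
  | Seq c1 c2 | If _ c1 c2 => no_read c1 && no_read c2
  | Loop _ c1 => no_read c1
  | _ => true
  end.

Lemma eval_inp c s : no_read c -> inp (eval c s) = inp s.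
Proof.
elim: c s => //= [c1 IH1 c2 IH2|y c1 IH1 c2 IH2|y c1 IH1] s.
- by case/andP=> h1 h2; rewrite IH2 // IH1.
- by case/andP=> h1 h2; case: ifP => _; [apply: IH1 | apply: IH2].
- by move=> h; elim: (var s y) => //= m <-; apply: IH1.
Qed.

Lemma iter_ind_inv (T : Type) (I : nat -> T -> Prop) (f : T -> T) n x :
  I 0 x -> (forall i y, i < n -> I i y -> I i.+1 (f y)) -> I n (iter n f x).
Proof.
move=> h0 hS; elim: n hS => //= n IH hS; apply: (hS) => //.
by apply: IH => i y hi; apply: hS; lia.
Qed.

Definition same_outside (c : cmd) (s y : store) : Prop :=
  (forall x, x \notin wvars c -> var y x = var s x) /\
  (forall a, a \notin warrs c -> arr y a = arr s a).

(** Frame facts come for free in the induction step, so [I] has to mention only what the body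
    changes. *)
Lemma loop_inv (I : nat -> store -> Prop) x c s :
  I 0 s ->
  (forall i y, i < var s x -> same_outside c s y -> I i y -> I i.+1 (eval c y)) ->
  I (var s x) (eval (Loop x c) s).
Proof.
move=> h0 hS.
have [] // := @iter_ind_inv _ (fun i y => same_outside c s y /\ I i y)
  (eval c) (var s x) s.
move=> i y hi [[fv fa] hI]; split; last exact: hS.
by split=> [z hz|a ha]; [rewrite eval_frame_var ?fv | rewrite eval_frame_arr ?fa].
Qed.

(** * Reversing a set of arcs *)

Definition flip (G : cgraph) (C X : config G) : config G :=
  (C :\: X) :|: [set (d.2, d.1) | d in X].

Lemma in_flip G (C X : config G) u v :
  ((u, v) \in flip C X) = ((u, v) \in C) && ((u, v) \notin X) || ((v, u) \in X).
Proof.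
rewrite !inE andbC; congr (_ || _); apply/imsetP/idP => [[[a b] h [-> ->]] //|h].
by exists (v, u).
Qed.

Lemma orientation_asym G (C : config G) u v :
  orientation C -> (u, v) \in C -> (v, u) \notin C.
Proof. by case=> h1 h2 h; rewrite -h2 // h1. Qed.

Lemma orientation_neq G (C : config G) u v :
  orientation C -> (u, v) \in C -> u != v.
Proof.
move=> [h1 _] /h1; apply: contraTneq => ->.
by rewrite adj_irr.
Qed.

Lemma flip_orientation G (C X : config G) :
  orientation C -> X \subset C -> orientation (flip C X).
Proof.
move=> oC /subsetP sX; split=> u v; have [h1 h2] := oC.
  rewrite in_flip => /orP[/andP[/h1 //]|/sX /h1].
  by rewrite adj_sym.
move=> huv; rewrite !in_flip h2 //.
have := sX (u, v); have := sX (v, u); rewrite (h2 u v) //.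
case: ((v, u) \in C); case: ((u, v) \in X); case: ((v, u) \in X)  => //= a b;
  first [by have := a isT | by have := b isT].
Qed.

Lemma inflow_arcs G (C : config G) v :
  inflow C v = \sum_(d in C | d.2 == v) weight d.1 d.2.
Proof.
rewrite (reindex_onto (fun u => (u, v)) (fun d => d.1)).
  by apply: eq_bigl => u; rewrite /= !eqxx !andbT.
by case=> a b /= /andP[_ /eqP ->].
Qed.

(** Arcs of [X] into [v] are lost and arcs of [X] out of [v] are gained. The balance is stated
    additively because subtraction on [nat] is truncated; it is checked neighbour by neighbour. *)
Lemma flip_inflow G (C X : config G) v : orientation C -> X \subset C ->
  inflow (flip C X) v + \sum_(d in X | d.2 == v) weight d.1 d.2 =
  inflow C v + \sum_(d in X | d.1 == v) weight d.1 d.2.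
Proof.
move=> oC /subsetP sX.
rewrite -(inflow_arcs X).
have -> : \sum_(d in X | d.1 == v) weight d.1 d.2 =
          \sum_(u | (v, u) \in X) weight u v.
  rewrite (reindex_onto (fun u => (v, u)) (fun d => d.2)).
    by apply: eq_big => u; rewrite /= ?eqxx ?andbT // weight_sym.
  by case=> a b /= /andP[_ /eqP ->].
rewrite /inflow [in LHS]big_mkcond [X in _ + X = _]big_mkcond -big_split /=.
rewrite [in RHS]big_mkcond [X in _ = _ + X]big_mkcond -big_split /=.
apply: eq_bigr => u _; rewrite in_flip.
have := @orientation_asym _ _ v u oC; have := sX (u, v); have := sX (v, u).
case: ((u, v) \in C); case: ((v, u) \in C); case: ((u, v) \in X);
  case: ((v, u) \in X) => //= a b c; rewrite ?addn0 ?add0n //;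
  first [by have := a isT | by have := b isT | by have := c isT].
Qed.

Lemma flip_target G (C1 C2 : config G) :
  orientation C1 -> orientation C2 -> flip C1 (C1 :\: C2) = C2.
Proof.
move=> o1 o2; apply/setP=> -[u v]; rewrite in_flip !inE.
have [a1 s1] := o1; have [a2 s2] := o2.
have [huv|nuv] := boolP (adj u v).
  rewrite (s1 u v) // (s2 u v) //.
  by case: ((v, u) \in C1); case: ((v, u) \in C2).
have n1 : (u, v) \notin C1 by apply: contra nuv => /a1.
have n2 : (u, v) \notin C2 by apply: contra nuv => /a2.
have n3 : (v, u) \notin C1 by apply: contra nuv => /a1; rewrite adj_sym.
by rewrite (negPf n1) (negPf n2) (negPf n3) /= andbF.
Qed.

(** The reversed set can be read off the final configuration; this is what forces it to be
    [C1 :\: C2]. *)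
Lemma flip_diff G (C X : config G) :
  orientation C -> X \subset C -> C :\: flip C X = X.
Proof.
move=> oC /subsetP sX; apply/setP=> -[u v]; rewrite inE in_flip.
have := @orientation_asym _ _ v u oC; have := sX (u, v); have := sX (v, u).
case: ((u, v) \in C); case: ((v, u) \in C); case: ((u, v) \in X);
  case: ((v, u) \in X) => //= a b c;
  first [by have := a isT | by have := b isT | by have := c isT].
Qed.

Lemma flip_add G (C X : config G) u v :
  orientation C -> X \subset C -> (u, v) \in C -> (u, v) \notin X ->
  flip C ((u, v) |: X) = reverse (flip C X) u v.
Proof.
move=> oC /subsetP sX hC hX; apply/setP=> -[a b].
rewrite /reverse in_setU1 in_setD1 !in_flip !in_setU1 !negb_or.
have nvu : (v, u) \notin X.
  by apply: contra (orientation_asym oC hC) => /sX.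
have -> : ((b, a) == (u, v)) = ((a, b) == (v, u)).
  by apply/eqP/eqP=> -[-> ->].
case: (eqVneq (a, b) (v, u)) => [_|_] /=; first by rewrite !orbT.
case: (eqVneq (a, b) (u, v)) => [[-> ->]|_] //=.
by rewrite (negPf nvu) andbF.
Qed.

Lemma reversesC G u v (C C' : config G) : reverses u v C C' = reverses v u C C'.
Proof. by rewrite /reverses orbC. Qed.

Lemma times_reversedC G (C : config G) s u v :
  times_reversed C s u v = times_reversed C s v u.
Proof. by apply: eq_count => CC; rewrite reversesC. Qed.

Lemma times_reversed_rcons G (C C' : config G) s u v :
  times_reversed C (rcons s C') u v =
  times_reversed C s u v + reverses u v (last C s) C'.
Proof.
elim: s C => [|C0 s IH] C; first by rewrite /times_reversed /= addn0.
rewrite /times_reversed /= -/(times_reversed C0 (rcons s C') u v) IH.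
by rewrite addnA.
Qed.

Definition inflow_ok G (C : config G) : bool :=
  [forall v, min_inflow v <= inflow C v].

(* Meaningful only for m = #|X|: the arcs of X can be reversed one after the
   other, starting from C, through legal configurations. *)
Fixpoint reachable G (C : config G) (m : nat) (X : config G) : bool :=
  if m is m'.+1
  then inflow_ok (flip C X) && [exists d in X, reachable C m' (X :\ d)]
  else true.

(** The arc that [reachable] removes from [X] is the one reversed last. The bound on
    [times_reversed] is sharper than boundedness: it is 0 for edges outside [X], which leaves room
    for the new reversal in the induction. *)
Lemma reachable_seq G (C X : config G) m :
  legal C -> X \subset C -> #|X| = m -> reachable C m X ->
  exists s, [/\ reconf_seq C (flip C X) s, size s = m
    & forall u v, times_reversed C s u v <= ((u, v) \in X) || ((v, u) \in X)].
Proof.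
move=> lC; have oC := lC.1; elim: m X => [|m IH] X sX cX.
  move=> _; exists [::]; split=> //.
  have -> : X = set0 by apply/eqP; rewrite -cards_eq0 cX.
  have -> : flip C set0 = C.
    by apply/setP=> -[u v]; rewrite in_flip !inE /= andbT orbF.
  by split=> // C'; rewrite inE => /eqP->.
case/andP=> okX /exists_inP[[a b] hd hr].
have hdC : (a, b) \in C by apply: (subsetP sX).
set Y := X :\ (a, b) in hr.
have sY : Y \subset C by apply: subset_trans sX; apply: subsetDl.
have cY : #|Y| = m by move: cX; rewrite (cardsD1 (a, b)) hd => -[].
have eX : X = (a, b) |: Y by rewrite setD1K.
have nY : (a, b) \notin Y by rewrite !inE eqxx.
have eF : flip C X = reverse (flip C Y) a b by rewrite eX flip_add.
have [s [[h1 h2 h3] h4 h5]] := IH _ sY cY hr.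
exists (rcons s (flip C X)); split.
- split; last by rewrite last_rcons.
    move=> C'; rewrite -rcons_cons mem_rcons inE => /orP[/eqP->|/h1 //].
    split; first exact: flip_orientation.
    by apply/forallP.
  rewrite rcons_path h2 h3; apply/existsP; exists a; apply/existsP; exists b.
  by rewrite /reverses eF eqxx in_flip hdC nY.
- by rewrite size_rcons h4.
move=> u v; rewrite times_reversed_rcons h3.
have oY := flip_orientation oC sY.
(* The two configurations determine the reversed arc: it lies in [flip C Y] but not in [flip C X],
   and [(a, b)] is the only such arc. Hence the last step counts for no other edge. *)
have key x y : (x, y) \in flip C Y -> flip C X = reverse (flip C Y) x y ->
    (x, y) = (a, b).
  move=> hxy e.
  have nXY : (x, y) \notin flip C X.
    rewrite e /reverse in_setU1 in_setD1 eqxx /= orbF.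
    by apply: contra (orientation_neq oY hxy) => /eqP[->].
  move: hxy nXY; rewrite !in_flip eX !in_setU1 !negb_or !negb_and !negbK.
  case: ((x, y) \in C) => /=; case: ((y, x) \in Y) => /=; rewrite ?orbT ?andbF //.
  case: ((x, y) \in Y) => //= _.
  by rewrite orbF -negb_and negbK => /andP[/andP[/eqP-> /eqP->]].
have hba : (b, a) \notin X.
  by apply: contra (orientation_asym oC hdC); apply: (subsetP sX).
have hr2 : reverses u v (flip C Y) (flip C X) -> (u, v) = (a, b) \/ (v, u) = (a, b).
  by case/orP=> /andP[h /eqP /(key _ _ h)]; [left|right].
have := h5 u v.
case: (boolP (reverses _ _ _ _)) => [/hr2[][-> ->]|_]; rewrite ?hd ?(negPf hba) ?orbT.
- by rewrite (negPf nY) !inE (negPf hba) andbF /=; lia.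
- by rewrite (negPf nY) !inE (negPf hba) andbF /=; lia.
rewrite addn0 => h; apply: leq_trans h _.
rewrite /Y !in_setD1.
by case: (_ == _); case: (_ == _); case: ((u, v) \in X); case: ((v, u) \in X).
Qed.

(** Induction on the last step, which reverses an arc [(a, b)] of [flip C X]. Were [(b, a)] in [X],
    its edge would already have been reversed, by the last clause, and boundedness would fail. So
    [(a, b)] is an arc of [C] outside [X], and [X] grows by it. *)
Lemma seq_reachable G (C : config G) s : legal C ->
  (forall C', C' \in C :: s -> legal C') -> path (@reversal G) C s ->
  bounded C s ->
  exists X : config G, [/\ X \subset C, last C s = flip C X, #|X| = size s,
    reachable C #|X| X
  & forall u v, (u, v) \in X -> 0 < times_reversed C s u v].
Proof.
move=> lC; have oC := lC.1; elim/last_ind: s => [|s C' IH] hl hp hb.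
  exists set0; rewrite cards0; split=> //; rewrite ?sub0set //.
    by apply/setP=> -[u v]; rewrite in_flip !inE /= andbT orbF.
  by move=> u v; rewrite inE.
move: hp; rewrite rcons_path => /andP[hp hrev].
have hb' : bounded C s.
  by move=> u v /hb; rewrite times_reversed_rcons; lia.
have [|X [sX eX cX rX tX]] := IH _ hp hb'.
  by move=> C0 h; apply: hl; rewrite -rcons_cons mem_rcons inE h orbT.
have oX := flip_orientation oC sX.
have [a [b [hab eC' hr]]] : exists a b, [/\ (a, b) \in flip C X,
    C' = reverse (flip C X) a b & reverses a b (flip C X) C'].
  case/existsP: hrev => u /existsP[v]; rewrite eX /reverses.
  case/orP=> /andP[h /eqP e]; [exists u, v|exists v, u]; split=> //;
    by rewrite h e eqxx.
have t0 : times_reversed C s a b = 0.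
  have /hb : adj a b by apply: oX.1.
  by rewrite times_reversed_rcons eX hr; lia.
have nba : (b, a) \notin X.
  by apply/negP=> /tX; rewrite times_reversedC t0.
move: (hab); rewrite in_flip (negPf nba) orbF => /andP[habC nab].
have cX' : #|(a, b) |: X| = (size s).+1 by rewrite cardsU1 nab cX.
have eF : flip C ((a, b) |: X) = C' by rewrite flip_add.
exists ((a, b) |: X); split.
- by rewrite subUset sub1set habC.
- by rewrite last_rcons eF.
- by rewrite cX' size_rcons.
- rewrite cX' /=; apply/andP; split.
    have [_ h] : legal C' by apply: hl; rewrite -rcons_cons mem_rcons inE eqxx.
    by rewrite eF; apply/forallP.
  apply/exists_inP; exists (a, b); first by rewrite !inE eqxx.
  by rewrite setU1K // -cX.
move=> u v; rewrite in_setU1 times_reversed_rcons => /orP[/eqP[-> ->]|/tX]; last by lia.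
by rewrite eX hr addn1.
Qed.

Lemma ncl_yesE (x : ncl_instance) :
  let C1 := ncl_start x in
  let D := C1 :\: ncl_target x in
  ncl_yes x <-> reachable C1 #|D| D && (#|D| <= ncl_length x).
Proof.
move=> C1 D; have l1 := ncl_start_legal x; have l2 := ncl_target_legal x.
split.
  case=> s [[hl hp hlast] hb hs].
  have [X [sX eX cX rX _]] := seq_reachable l1 hl hp hb.
  have eD : D = X by rewrite /D -hlast eX flip_diff //; case: l1.
  by rewrite eD rX cX.
case/andP=> hr hD.
have [|s [hs sz ht]] := reachable_seq l1 _ erefl hr; first exact: subsetDl.
exists s; split; last by rewrite sz.
- by rewrite flip_target in hs; [|case: l1|case: l2].
- by move=> u v _; apply: leq_trans (ht u v) _; case: (_ || _).
Qed.

(** * Bit masks *)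

Definition bit (S i : nat) : bool := odd (S %/ 2 ^ i).

Lemma modn_bit S i : S %% 2 ^ i.+1 = bit S i * 2 ^ i + S %% 2 ^ i.
Proof.
have h0 : 0 < 2 ^ i by rewrite expn_gt0.
have hr := ltn_pmod S h0.
have e : S = (S %/ 2 ^ i)./2 * 2 ^ i.+1 + (bit S i * 2 ^ i + S %% 2 ^ i).
  rewrite {1}(divn_eq S (2 ^ i)) -{1}(odd_double_half (S %/ 2 ^ i)) expnS /bit -muln2.
  by lia.
rewrite {1}e modnMDl modn_small // expnS; case: (bit S i); lia.
Qed.

(** The bit test available without division, once all higher bits have been removed from [S]. *)
Lemma bit_geE S i : (2 ^ i <= S %% 2 ^ i.+1) = bit S i.
Proof.
have h0 : 0 < 2 ^ i by rewrite expn_gt0.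
rewrite modn_bit; have := ltn_pmod S h0; case: (bit S i); lia.
Qed.

Lemma bit_ge S i : bit S i -> 2 ^ i <= S.
Proof. by rewrite -bit_geE => h; apply: leq_trans h (leq_mod _ _). Qed.

(** No borrow occurs. Write [S = q * 2 ^ i.+1 + (2 ^ i + r)] with [r < 2 ^ i]: for [j < i] the first
    two terms are even multiples of [2 ^ j], and for [j > i] what stands beside [q * 2 ^ i.+1] is
    below [2 ^ i.+1] and vanishes in the quotient. *)
Lemma bit_sub S i j : bit S i -> bit (S - 2 ^ i) j = bit S j && (j != i).
Proof.
move=> hi; set r := S %% 2 ^ i.
have h0 k : 0 < 2 ^ k by rewrite expn_gt0.
have hr : r < 2 ^ i by rewrite ltn_pmod.
set q := (S %/ 2 ^ i)./2.
have eS : S = q * 2 ^ i.+1 + (2 ^ i + r).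
  rewrite {1}(divn_eq S (2 ^ i)) -{1}(odd_double_half (S %/ 2 ^ i)) -/(bit S i) hi.
  by rewrite -/r -/q expnS -muln2; lia.
have eT : S - 2 ^ i = q * 2 ^ i.+1 + r by lia.
rewrite /bit eT eS; case: (ltngtP j i) => [hj|hj|->].
- have e1 : 2 ^ i = (2 ^ (i - j.+1)).*2 * 2 ^ j.
    by rewrite -{1}(subnK hj) expnD expnS -muln2; lia.
  have e2 : q * 2 ^ i.+1 = (q * 2 * 2 ^ (i - j.+1)).*2 * 2 ^ j.
    by rewrite expnS e1 -!muln2; lia.
  by rewrite andbT e2 e1 !divnMDl // !oddD !odd_double.
- have -> : 2 ^ j = 2 ^ i.+1 * 2 ^ (j - i.+1) by rewrite -expnD subnKC.
  rewrite andbT !divnMA !divnMDl //.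
  have h2 : 2 ^ i + r < 2 ^ i.+1 by rewrite expnS; lia.
  by rewrite (divn_small h2) (divn_small (leq_ltn_trans (leq_addl _ _) h2)).
- rewrite andbF expnS mulnA divnMDl // divn_small // addn0 muln2.
  by rewrite odd_double.
Qed.

Lemma bit_pred_exp K i : i < K -> bit (2 ^ K - 1) i.
Proof.
move=> hi; rewrite -bit_geE.
have h0 k : 0 < 2 ^ k by rewrite expn_gt0.
have -> : 2 ^ K - 1 = (2 ^ (K - i.+1) - 1) * 2 ^ i.+1 + (2 ^ i.+1 - 1).
  rewrite -{1}(subnK hi) expnD mulnBl mul1n.
  have : 2 ^ i.+1 <= 2 ^ (K - i.+1) * 2 ^ i.+1 by rewrite leq_pmull.
  have := h0 i.+1; lia.
rewrite modnMDl modn_small; last by rewrite subn1 prednK.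
by rewrite expnS; have := h0 i; lia.
Qed.

Lemma bits_eq0 K S : S < 2 ^ K -> (forall i, i < K -> ~~ bit S i) -> S = 0.
Proof.
move=> hS hb; rewrite -(modn_small hS); elim: K hb {hS} => [|K IH] hb.
  by rewrite modn1.
rewrite modn_bit (negPf (hb _ _)) // IH // => i hi.
by apply: hb; lia.
Qed.

Definition maskset (T : finType) (dl : seq T) (S : nat) : {set T} :=
  [set d in dl | bit S (index d dl)].

Lemma maskset_sub (T : finType) (dl : seq T) S : {subset maskset dl S <= dl}.
Proof. by move=> d; rewrite inE => /andP[]. Qed.

Lemma maskset_rem (T : finType) (dl : seq T) S d :
  d \in maskset dl S -> maskset dl (S - 2 ^ index d dl) = maskset dl S :\ d.
Proof.
rewrite inE => /andP[hd hb]; apply/setP=> e; rewrite !inE bit_sub //.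
case he: (e \in dl); rewrite ?andbF //= andbC; congr (~~ _ && _).
by apply/eqP/eqP => [|-> //]; apply: index_inj.
Qed.

Lemma maskset_full (T : finType) (dl : seq T) :
  maskset dl (2 ^ size dl - 1) = [set d in dl].
Proof.
apply/setP=> d; rewrite !inE; case hd: (d \in dl) => //=.
by rewrite bit_pred_exp // index_mem.
Qed.

Lemma maskset_eq0 (T : finType) (dl : seq T) S :
  uniq dl -> S < 2 ^ size dl -> (maskset dl S == set0) = (S == 0).
Proof.
move=> u hS; apply/eqP/eqP => [h|->]; last first.
  by apply/setP=> d; rewrite !inE /bit div0n andbF.
apply: bits_eq0 hS _ => i hi; apply/negP => hb.
case: dl u h hi => // d0 dl u h hi.
suff : nth d0 (d0 :: dl) i \in maskset (d0 :: dl) S by rewrite h inE.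
by rewrite inE mem_nth // index_uniq.
Qed.

(** Turns a sum over a set of arcs into the sum over bit positions that the machine computes; [h]
    forgets the ordinal types, as the machine stores plain numbers. *)
Lemma sum_maskset (T : finType) (T' : eqType) (dl : seq T) (h : T -> T') x0 S
    (P : pred T) (P' : pred T') (f : T -> nat) (f' : T' -> nat) :
  uniq dl -> injective h -> (forall d, P d = P' (h d)) ->
  (forall d, f d = f' (h d)) ->
  \sum_(d in maskset dl S | P d) f d =
  \sum_(0 <= i < size dl | bit S i && P' (nth x0 (map h dl) i))
     f' (nth x0 (map h dl) i).
Proof.
move=> u hi hP hf.
transitivity (\sum_(d <- map h dl | bit S (index d (map h dl)) && P' d) f' d).
  rewrite big_map [RHS]big_mkcond [RHS]big_uniq //= -[RHS]big_mkcondr /=.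
  apply: eq_big => d; last by rewrite hf.
  by rewrite inE index_map // hP andbA.
rewrite (big_nth x0) size_map big_nat_cond [RHS]big_nat_cond.
apply: eq_bigl => i; case: ltnP => //= hi'.
by rewrite index_uniq ?size_map // map_inj_uniq.
Qed.

(** * The recurrence on masks *)

Definition mask_reachable G (C : config G) dl S : bool :=
  reachable C #|maskset dl S| (maskset dl S).

(** The choice of an arc becomes a search for a set bit. For the empty mask [reachable] makes no
    inflow test, but legality of [C] makes the test succeed, so the program can treat mask 0 like
    the others. *)
Lemma mask_reachableE G (C : config G) dl S :
  legal C -> uniq dl -> {subset dl <= C} -> S < 2 ^ size dl ->
  mask_reachable C dl S =
  inflow_ok (flip C (maskset dl S)) &&
  ((S == 0) || has (fun i => bit S i && mask_reachable C dl (S - 2 ^ i))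
                   (iota 0 (size dl))).
Proof.
move=> lC u sC hS; rewrite -(maskset_eq0 u hS) /mask_reachable.
case cX: #|maskset dl S| => [|m].
  have -> : maskset dl S = set0 by apply/eqP; rewrite -cards_eq0 cX.
  have -> : flip C set0 = C.
    by apply/setP=> -[a b]; rewrite in_flip !inE /= andbT orbF.
  by rewrite eqxx andbT; apply/esym/forallP; case: lC.
have -> : (maskset dl S == set0) = false by rewrite -cards_eq0 cX.
rewrite [LHS]/=; congr (_ && _).
have key d : d \in maskset dl S -> #|maskset dl (S - 2 ^ index d dl)| = m.
  by move=> hd; rewrite maskset_rem //; move: cX; rewrite (cardsD1 d) hd => -[].
apply/exists_inP/hasP => [[d hd hr]|[i]].
  exists (index d dl).
    by rewrite mem_iota /= add0n index_mem; apply: maskset_sub hd.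
  rewrite key // maskset_rem // hr andbT.
  by move: hd; rewrite inE => /andP[].
rewrite mem_iota add0n /= => hi /andP[hb hr].
case: dl u sC hS cX key hi hr => // d0 dl' u sC hS cX key hi hr.
have ei := index_uniq d0 hi u.
have hd : nth d0 (d0 :: dl') i \in maskset (d0 :: dl') S.
  by rewrite inE mem_nth // ei.
exists (nth d0 (d0 :: dl') i) => //.
by move: hr; rewrite -{1 2}ei key // maskset_rem.
Qed.

(** The inflow condition after reversal, rearranged by [flip_inflow]: arc [i] runs from [U i] to
    [V i], so its reversal costs [V i] the weight [W i] and gives it to [U i]. *)
Definition mask_ok (n K : nat) (mn F U V W : nat -> nat) (S : nat) : bool :=
  all (fun v =>
    mn v + \sum_(0 <= i < K | bit S i && (V i == v)) W i <=
    F v + \sum_(0 <= i < K | bit S i && (U i == v)) W i) (iota 0 n).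

Definition nat2 n (d : 'I_n * 'I_n) : nat * nat := (nat_of_ord d.1, nat_of_ord d.2).

Lemma nat2_inj n : injective (@nat2 n).
Proof. by case=> a b [c d] [/val_inj /= -> /val_inj /= ->]. Qed.

Lemma mask_okE G (C : config G) dl S (mn F : nat -> nat) (w : nat * nat -> nat) :
  orientation C -> uniq dl -> {subset dl <= C} ->
  (forall v : 'I_(nv G), mn v = min_inflow v) ->
  (forall v : 'I_(nv G), F v = inflow C v) ->
  (forall d : 'I_(nv G) * 'I_(nv G), d \in C -> w (nat2 d) = weight d.1 d.2) ->
  let e := nth (0, 0) (map (@nat2 _) dl) in
  inflow_ok (flip C (maskset dl S)) =
  mask_ok (nv G) (size dl) mn F (fun i => (e i).1) (fun i => (e i).2)
    (fun i => w (e i)) S.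
Proof.
move=> oC u sC hmn hF hw e.
have sX : maskset dl S \subset C by apply/subsetP=> d /maskset_sub /sC.
pose f d := w (@nat2 (nv G) d).
have sumE (P : pred ('I_(nv G) * 'I_(nv G))) :
    \sum_(d in maskset dl S | P d) weight d.1 d.2 =
    \sum_(d in maskset dl S | P d) f d.
  by apply: eq_bigr => d /andP[/(subsetP sX) hd _]; rewrite /f hw.
have okE (v : 'I_(nv G)) : (min_inflow v <= inflow (flip C (maskset dl S)) v) =
    (mn v + \sum_(0 <= i < size dl | bit S i && ((e i).2 == v)) w (e i) <=
     F v + \sum_(0 <= i < size dl | bit S i && ((e i).1 == v)) w (e i)).
  have := flip_inflow v oC sX; rewrite !sumE.
  rewrite (sum_maskset (h := @nat2 _) (0, 0) S (P' := fun d => d.2 == v)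
    (f' := w) u (@nat2_inj _)) //.
  rewrite (sum_maskset (h := @nat2 _) (0, 0) S (P' := fun d => d.1 == v)
    (f' := w) u (@nat2_inj _)) //.
  rewrite -/e hmn hF => h.
  by rewrite -(leq_add2r (\sum_(0 <= i < size dl | bit S i && ((e i).2 == v)) w (e i))) h.
apply/forallP/allP => [h v|h v].
  by rewrite mem_iota add0n => /= hv; have := h (Ordinal hv); rewrite okE.
by rewrite okE; apply: h; rewrite mem_iota add0n /=.
Qed.

(** * The program *)

(* xn and xnn hold n and n^2; xK is the number of arcs to reverse, xN the number
   of masks; xone and xzero are constants. *)
Local Notation xok := 0 (only parsing).
Local Notation xn := 1 (only parsing).
Local Notation xnn := 2 (only parsing).
Local Notation xK := 3 (only parsing).
Local Notation xN := 4 (only parsing).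
Local Notation xi := 5 (only parsing).
Local Notation xt := 6 (only parsing).
Local Notation xone := 7 (only parsing).
Local Notation xl := 8 (only parsing).
Local Notation xu := 9 (only parsing).
Local Notation xv := 10 (only parsing).
Local Notation xe := 11 (only parsing).
Local Notation xp := 12 (only parsing).
Local Notation xS := 13 (only parsing).
Local Notation xT := 14 (only parsing).
Local Notation xc := 15 (only parsing).
Local Notation xr := 16 (only parsing).
Local Notation xzero := 17 (only parsing).

(* aF is the inflow in the start configuration.  Arc i to be reversed runs from
   aU to aV with weight aW, and aP holds 2^i.  For the current mask, aG and aH
   are inflow + gained weight and minimum inflow + lost weight, so that no
   truncated subtraction occurs.  aR is the table of reachable masks. *)
Local Notation aWt := 0 (only parsing).
Local Notation aMn := 1 (only parsing).
Local Notation aC1 := 2 (only parsing).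
Local Notation aC2 := 3 (only parsing).
Local Notation aF := 4 (only parsing).
Local Notation aU := 5 (only parsing).
Local Notation aV := 6 (only parsing).
Local Notation aW := 7 (only parsing).
Local Notation aP := 8 (only parsing).
Local Notation aG := 9 (only parsing).
Local Notation aH := 10 (only parsing).
Local Notation aR := 11 (only parsing).

Definition read_array (a x : nat) : cmd :=
  (Const xi 0 ;; Loop x (Read xt ;; Put a xi xt ;; Add xi xi xone))%cmd.

Definition square : cmd := (Const xnn 0 ;; Loop xn (Add xnn xnn xn))%cmd.

Definition cell_body : cmd :=
  (Get xt aC1 xe ;;
   If xt (Get xt aWt xe ;; Get xr aF xv ;; Add xr xr xt ;; Put aF xv xr ;;
          Get xc aC2 xe ;;
          If xc Skip (Put aU xK xu ;; Put aV xK xv ;; Put aW xK xt ;;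
                      Add xK xK xone)) Skip ;;
   Add xe xe xone ;; Add xv xv xone)%cmd.

Definition row_body : cmd :=
  (Const xv 0 ;; Loop xn cell_body ;; Add xu xu xone)%cmd.

Definition collect : cmd :=
  (Const xK 0 ;; Const xe 0 ;; Const xu 0 ;; Loop xn row_body)%cmd.

Definition powers : cmd :=
  (Const xi 0 ;; Const xp 1 ;;
   Loop xK (Put aP xi xp ;; Add xp xp xp ;; Add xi xi xone))%cmd.

(** [K <= l] is tested as [0 < l + 1 - K], and [xp] still holds [2 ^ K] from [powers]. With count 0
    the mask loop does nothing and its initial [xok = 0] stands as the answer no. *)
Definition mask_count : cmd :=
  (Add xt xl xone ;; Sub xt xt xK ;; If xt (Add xN xp xzero) (Const xN 0))%cmd.

Definition copy_loop : cmd :=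
  (Const xv 0 ;;
   Loop xn (Get xt aF xv ;; Put aG xv xt ;; Get xt aMn xv ;; Put aH xv xt ;;
            Add xv xv xone))%cmd.

Definition add_at (a b : nat) : cmd :=
  (Get xu a xi ;; Get xr b xu ;; Add xr xr xt ;; Put b xu xr)%cmd.

Definition probe : cmd :=
  (Sub xr xS xp ;; Get xr aR xr ;; If xr (Const xok 1) Skip)%cmd.

Definition flip_bit : cmd :=
  (Sub xT xT xp ;; Get xt aW xi ;; add_at aV aH ;; add_at aU aG ;;
   probe)%cmd.

(** [xT] is the mask without its bits above the new [xi], so this bit is set iff [2 ^ xi <= xT],
    that is, iff [xT + 1 - 2 ^ xi] is positive. *)
Definition next_bit : cmd :=
  (Sub xi xi xone ;; Get xp aP xi ;; Add xc xT xone ;; Sub xc xc xp)%cmd.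

Definition bit_body : cmd := (next_bit ;; If xc flip_bit Skip)%cmd.

Definition check_loop : cmd :=
  (Const xv 0 ;;
   Loop xn (Get xt aH xv ;; Get xr aG xv ;; Sub xt xt xr ;;
            If xt (Const xok 0) Skip ;; Add xv xv xone))%cmd.

(** [xok] starts as the truth value of [S = 0], is raised by any reachable predecessor, and is
    cleared by any vertex short of inflow. *)
Definition mask_body : cmd :=
  (copy_loop ;;
   (Add xT xS xzero ;; Add xi xK xzero ;; Const xok 1 ;;
    If xS (Const xok 0) Skip) ;;
   Loop xK bit_body ;;
   check_loop ;;
   Put aR xS xok ;; Add xS xS xone)%cmd.

Definition mask_loop : cmd :=
  (Const xok 0 ;; Const xS 0 ;; Loop xN mask_body)%cmd.

(** * Correctness of the parts of the program *)

Lemma read_arrayP a x s : x != xi -> x != xt -> var s xone = 1 ->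
  let s' := eval (read_array a x) s in
  (forall j, j < var s x -> arr s' a j = nth 0 (inp s) j) /\
  inp s' = drop (var s x) (inp s).
Proof.
move=> hx5 hx6 h7 s'.
pose s0 := setv s xi 0.
have ex : var s0 x = var s x by rewrite /s0 /= /upd (negPf hx5).
have := @loop_inv (fun k y => [/\ var y xi = k, inp y = drop k (inp s)
   & forall j, j < k -> arr y a j = nth 0 (inp s) j]) x
   (Read xt ;; Put a xi xt ;; Add xi xi xone)%cmd s0.
rewrite ex; case=> [|k y hk [fv fa] [h5 hi hj]|h5 hi hj] //.
  by rewrite /s0 /= drop0; split.
have {}fv : var y xone = 1 by rewrite fv.
rewrite /= /upd /= fv h5 eqxx; split; first by rewrite addn1.
  by rewrite hi -drop1 drop_drop add1n.
move=> j; rewrite ltnS leq_eqVlt => /orP[/eqP->|hjk].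
  by rewrite eqxx hi -nth0 nth_drop addn0.
by case: eqP => [->|_]; [rewrite hi -nth0 nth_drop addn0 | apply: hj].
Qed.

Lemma squareP s : var (eval square s) xnn = var s xn * var s xn.
Proof.
have := @loop_inv (fun k y => var y xnn = k * var s xn) xn
  (Add xnn xnn xn) (setv s xnn 0).
apply=> // k y hk [fv fa] h2.
by rewrite /= /upd /= h2 (fv xn) //= /upd /=; lia.
Qed.

(* Matrices are stored row by row, so the entry of arc d has index
   d.1 * n + d.2. *)
Definition collected (n : nat) (wt c1 c2 : nat -> nat) (l : seq (nat * nat))
    (s : store) : Prop :=
  let idx d := d.1 * n + d.2 in
  let dl := [seq d <- l | (0 < c1 (idx d)) && (c2 (idx d) == 0)] in
  [/\ var s xe = size l,
      forall v, arr s aF v =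
        \sum_(d <- l | (0 < c1 (idx d)) && (d.2 == v)) wt (idx d),
      var s xK = size dl
    & forall i, i < size dl ->
        [/\ arr s aU i = (nth (0, 0) dl i).1, arr s aV i = (nth (0, 0) dl i).2
          & arr s aW i = wt (idx (nth (0, 0) dl i))]].

(** [l] lists the cells already scanned, so its length is both the running index [xe] and the matrix
    index of the next cell [d]. The counter [xK] is at the same time the next free slot of the arc
    arrays. *)
Lemma cell_bodyP n wt c1 c2 l d s :
  var s xone = 1 -> arr s aWt = wt -> arr s aC1 = c1 -> arr s aC2 = c2 ->
  var s xu = d.1 -> var s xv = d.2 -> size l = d.1 * n + d.2 ->
  collected n wt c1 c2 l s -> collected n wt c1 c2 (rcons l d) (eval cell_body s).
Proof.
move=> h7 a0 a2 a3 h9 h10 sl [h11 hF hK hd].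
have e11 : var s xe = d.1 * n + d.2 by rewrite h11.
rewrite /collected filter_rcons.
have sumE v :
    \sum_(d0 <- rcons l d | (0 < c1 (d0.1 * n + d0.2)) && (d0.2 == v))
       wt (d0.1 * n + d0.2) =
    arr s aF v + (if (0 < c1 (d.1 * n + d.2)) && (d.2 == v)
                  then wt (d.1 * n + d.2) else 0).
  by rewrite hF -cats1 big_cat /= big_cons big_nil; case: ifP; rewrite ?addn0.
rewrite /= /upd /= a2 e11.
case: (posnP (c1 (d.1 * n + d.2))) => hc1 /=.
  rewrite /upd /= h7 e11 size_rcons sl addn1; split=> // v.
  by rewrite sumE hc1 /= addn0.
rewrite /upd /= a0 a3 ?e11 h10.
case: (posnP (c2 (d.1 * n + d.2))) => hc2 /=; last first.
  rewrite /upd /= h7 e11 size_rcons sl addn1; split=> // v.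
  by rewrite sumE hc1 /= [d.2 == v]eq_sym; case: eqP => [->|_]; rewrite ?addn0.
rewrite /upd /= h7 h9 hK e11 !size_rcons sl !addn1; split=> //.
- move=> v; rewrite sumE hc1 /= [d.2 == v]eq_sym; case: eqP => [->|_]; by rewrite ?addn0.
move=> i; rewrite ltnS leq_eqVlt nth_rcons => /orP[/eqP->|hi].
  by rewrite ltnn eqxx.
by rewrite (ltn_eqF hi) hi; apply: hd.
Qed.

Lemma collectP s : var s xone = 1 -> arr s aF =1 (fun _ => 0) ->
  collected (var s xn) (arr s aWt) (arr s aC1) (arr s aC2)
    [seq (u, v) | u <- iota 0 (var s xn), v <- iota 0 (var s xn)]
    (eval collect s).
Proof.
move=> h7 hF; set n := var s xn.
pose s0 := setv (setv (setv s xK 0) xe 0) xu 0.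
pose rows u := [seq (u', v) | u' <- iota 0 u, v <- iota 0 n].
have sz u : size (rows u) = u * n by rewrite size_allpairs !size_iota.
have [] // := @loop_inv (fun u y => var y xu = u /\
    collected n (arr s aWt) (arr s aC1) (arr s aC2) (rows u) y)
  xn row_body s0.
  by split=> //; split=> // v; rewrite big_nil /= hF.
move=> u y hu [fv fa] [h9 hc].
pose y0 := setv y xv 0.
have e1 : var y0 xn = n by rewrite /y0 /= /upd /= fv.
have := @loop_inv (fun v z => var z xv = v /\
    collected n (arr s aWt) (arr s aC1) (arr s aC2) 
      (rows u ++ [seq (u, v') | v' <- iota 0 v]) z)
    xn cell_body y0.
rewrite e1; case=> [|v z hv [gv ga] [g10 gc]|z10 zc].
- by split=> //; rewrite cats0.
- have g9 : var z xu = u by rewrite gv.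
  have z7 : var z xone = 1 by rewrite gv // /y0 /= /upd /= fv.
  split.
    have -> : var (eval cell_body z) xv = var z xv + 1.
      rewrite /= /upd /=; case: ifP => _; last by rewrite /= /upd /= z7.
      by rewrite /= /upd /=; case: ifP => _; rewrite /= /upd /= z7.
    by rewrite g10 addn1.
  rewrite -[v.+1]addn1 iotaD /= cats1 add0n map_rcons -rcons_cat.
  apply: cell_bodyP => //; try by rewrite ga // /y0 /= fa.
  by rewrite size_cat sz size_map size_iota.
have z9 : var (eval (Loop xn cell_body) y0) xu = u.
  by rewrite eval_frame_var.
have z7 : var (eval (Loop xn cell_body) y0) xone = 1.
  by rewrite eval_frame_var // /y0 /= /upd /= fv.
rewrite /row_body; set c := Loop xn cell_body in z10 zc z9 z7 *.
rewrite [eval _ _]/= -/y0 z9 z7; split; first by rewrite /= /upd /= addn1.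
have -> : rows u.+1 = rows u ++ [seq (u, v') | v' <- iota 0 n].
  by rewrite /rows -addn1 iotaD allpairs_cat add0n /= cats0.
by case: zc => k1 k2 k3 k4; split=> //=; rewrite /upd /=.
Qed.

Lemma powersP s : var s xone = 1 ->
  let s' := eval powers s in
  (forall i, i < var s xK -> arr s' aP i = 2 ^ i) /\ var s' xp = 2 ^ var s xK.
Proof.
move=> h7.
have [] := @loop_inv (fun k y => [/\ var y xi = k, var y xp = 2 ^ k
   & forall i, i < k -> arr y aP i = 2 ^ i]) xK
   (Put aP xi xp ;; Add xp xp xp ;; Add xi xi xone)%cmd (setv (setv s xi 0) xp 1) => //.
move=> k y hk [fv fa] [h5 h12 hP].
have y7 : var y xone = 1 by rewrite fv.
rewrite /= /upd /= h5 h12 y7 addn1 addnn -mul2n -expnS; split=> // i.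
rewrite ltnS leq_eqVlt => /orP[/eqP->|hi]; first by rewrite eqxx.
by rewrite (ltn_eqF hi) hP.
Qed.

Lemma mask_countP s : var s xone = 1 -> var s xzero = 0 ->
  var (eval mask_count s) xN = if var s xK <= var s xl then var s xp else 0.
Proof.
move=> h7 h17; rewrite /= /upd /= /upd /= h7 subn_gt0 addn1 ltnS.
by case: ifP => _ /=; rewrite /upd /= ?h17 ?addn0.
Qed.

Lemma copy_loopP s v : var s xone = 1 -> v < var s xn ->
  let s' := eval copy_loop s in
  arr s' aG v = arr s aF v /\ arr s' aH v = arr s aMn v.
Proof.
move=> h7 hv.
have [] := @loop_inv (fun k y => var y xv = k /\ forall v, v < k ->
     arr y aG v = arr s aF v /\ arr y aH v = arr s aMn v) xn
   (Get xt aF xv ;; Put aG xv xt ;; Get xt aMn xv ;; Put aH xv xt ;; Add xv xv xone)%cmd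
   (setv s xv 0) => //; last first.
  by move=> _ h; apply: h.
move=> k y hk [fv fa] [h10 h].
have y7 : var y xone = 1 by rewrite fv.
rewrite /= /upd /= h10 y7 addn1; split=> // w.
rewrite ltnS leq_eqVlt => /orP[/eqP->|hw]; first by rewrite eqxx !fa.
by rewrite (ltn_eqF hw); apply: h.
Qed.

Lemma add_atP a b s v :
  arr (eval (add_at a b) s) b v =
  arr s b v + (if arr s a (var s xi) == v then var s xt else 0).
Proof.
rewrite /= eqxx /upd /= eq_sym; case: eqP => [->|_] //.
by rewrite addn0.
Qed.

Lemma flip_bitP s :
  let s' := eval flip_bit s in
  [/\ var s' xT = var s xT - var s xp,
      var s' xok = if 0 < arr s aR (var s xS - var s xp) then 1 else var s xok,
      forall v, arr s' aH v = arr s aH v +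
        (if arr s aV (var s xi) == v then arr s aW (var s xi) else 0)
    & forall v, arr s' aG v = arr s aG v +
        (if arr s aU (var s xi) == v then arr s aW (var s xi) else 0)].
Proof.
pose s1 := eval (Sub xT xT xp ;; Get xt aW xi)%cmd s.
pose s2 := eval (add_at aV aH) s1; pose s3 := eval (add_at aU aG) s2.
move=> s'; have es : s' = eval probe s3 by [].
have v6 : var s2 xt = arr s aW (var s xi) by rewrite /s2 eval_frame_var.
split.
- by rewrite es eval_frame_var // /s3 eval_frame_var // /s2 eval_frame_var.
- have -> : var s' xok = if 0 < arr s3 aR (var s3 xS - var s3 xp) then 1 else var s3 xok.
    by rewrite es /= /upd /=; case: ifP.
  have fv x : x \in [:: xok; xp; xS] -> var s3 x = var s x.
    by rewrite !inE => /or3P[]/eqP->; rewrite /s3 eval_frame_var // /s2 eval_frame_var.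
  have -> : arr s3 aR = arr s aR by rewrite /s3 eval_frame_arr // /s2 eval_frame_arr.
  by rewrite !fv.
- move=> v; rewrite es eval_frame_arr // /s3 eval_frame_arr // /s2.
  by rewrite add_atP.
- move=> v; rewrite es eval_frame_arr // /s3 add_atP v6.
  by rewrite /s2 !eval_frame_arr // eval_frame_var.
Qed.

(** Bits are treated from the top: after [j] rounds [xT] is [S] modulo [2 ^ (K - j)], and the sums
    and the search cover the positions from [K - j] on. *)
Lemma bit_loopP s S (ok : bool) :
  let K := var s xK in
  var s xone = 1 -> (forall i, i < K -> arr s aP i = 2 ^ i) ->
  S < 2 ^ K -> var s xS = S -> var s xT = S -> var s xi = K -> var s xok = ok ->
  let s' := eval (Loop xK bit_body) s in
  [/\ var s' xok = ok || has (fun i => bit S i && (0 < arr s aR (S - 2 ^ i))) (iota 0 K),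
      forall v, arr s' aH v =
        arr s aH v + \sum_(0 <= i < K | bit S i && (arr s aV i == v)) arr s aW i
    & forall v, arr s' aG v =
        arr s aG v + \sum_(0 <= i < K | bit S i && (arr s aU i == v)) arr s aW i].
Proof.
move=> K h7 hP hS h13 h14 h5 h0.
have := @loop_inv (fun j y =>
  [/\ var y xi = K - j, var y xT = S %% 2 ^ (K - j),
      var y xok = ok || has (fun i => bit S i && (0 < arr s aR (S - 2 ^ i)))
                            (iota (K - j) j),
      forall v, arr y aH v =
        arr s aH v + \sum_(K - j <= i < K | bit S i && (arr s aV i == v)) arr s aW i
    & forall v, arr y aG v =
        arr s aG v + \sum_(K - j <= i < K | bit S i && (arr s aU i == v)) arr s aW i])
  xK bit_body s.
case=> [|j y hj [fv fa] [y5 y14 y0 yH yG]|_ _ k0 kH kG];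
  last by rewrite subnn in k0 kH kG; split.
- rewrite /= subn0 orbF modn_small //; split=> // v; by rewrite big_geq ?addn0.
have y7 : var y xone = 1 by rewrite fv.
have y13 : var y xS = S by rewrite fv.
have a8 : arr y aP = arr s aP by rewrite fa.
have a7 : arr y aW = arr s aW by rewrite fa.
have a6 : arr y aV = arr s aV by rewrite fa.
have a5 : arr y aU = arr s aU by rewrite fa.
have a11 : arr y aR = arr s aR by rewrite fa.
set m := K - j.+1.
have ej : K - j = m.+1 by rewrite /m; lia.
have hm : m < K by rewrite /m; lia.
rewrite ej in y5 y14 y0 yH yG.
have sumE (A : nat -> nat) v :
    \sum_(m <= i < K | bit S i && (A i == v)) arr s aW i =
    (if bit S m && (A m == v) then arr s aW m else 0) +
    \sum_(m.+1 <= i < K | bit S i && (A i == v)) arr s aW i.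
  by rewrite big_ltn_cond //; case: ifP.
pose y1 := eval next_bit y.
have y1c : var y1 xc = S %% 2 ^ m.+1 + 1 - 2 ^ m.
  by rewrite /y1 /= /upd /= y14 y7 y5 a8 subn1 hP.
have y1i : var y1 xi = m by rewrite /y1 /= /upd /= y5 y7 subn1.
have y1p : var y1 xp = 2 ^ m by rewrite /y1 /= /upd /= y7 y5 a8 subn1 hP.
have -> : eval bit_body y = if bit S m then eval flip_bit y1 else y1.
  transitivity (if 0 < var y1 xc then eval flip_bit y1 else y1); first by [].
  by rewrite y1c subn_gt0 addn1 ltnS bit_geE.
case: (boolP (bit S m)) => hb; last first.
  split=> //.
  - by rewrite /y1 eval_frame_var // y14 modn_bit (negPf hb).
  - by rewrite /y1 eval_frame_var // y0 /= (negPf hb).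
  - by move=> v; rewrite sumE (negPf hb) /y1 eval_frame_arr.
  - by move=> v; rewrite sumE (negPf hb) /y1 eval_frame_arr.
have [f14 f0 fH fG] := flip_bitP y1.
have fr : [/\ var y1 xT = var y xT, var y1 xS = S, var y1 xok = var y xok
    & arr y1 = arr y].
  by split.
have [e14 e13 e0 ea] := fr.
rewrite ea a11 a7 a6 a5 y1i y1p e14 e13 e0 in f14 f0 fH fG; split.
- by rewrite eval_frame_var.
- by rewrite f14 y14 modn_bit hb mul1n addKn.
- rewrite f0 y0 /= hb /=; case: (_ < arr _ _ _) => //=.
  by rewrite orbT.
- by move=> v; rewrite fH yH sumE hb -addnA; congr (_ + _); rewrite addnC.
- by move=> v; rewrite fG yG sumE hb -addnA; congr (_ + _); rewrite addnC.
Qed.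

Lemma check_loopP s (ok : bool) : var s xone = 1 -> var s xok = ok ->
  var (eval check_loop s) xok =
  ok && all (fun v => arr s aH v <= arr s aG v) (iota 0 (var s xn)).
Proof.
move=> h7 h0.
have [] := @loop_inv (fun k y => var y xv = k /\
    var y xok = ok && all (fun v => arr s aH v <= arr s aG v) (iota 0 k)) xn
   (Get xt aH xv ;; Get xr aG xv ;; Sub xt xt xr ;; If xt (Const xok 0) Skip ;;
    Add xv xv xone)%cmd (setv s xv 0); [by rewrite andbT| |by []].
move=> k y hk [fv fa] [h10 hok].
have y7 : var y xone = 1 by rewrite fv.
have a10 : arr y aH = arr s aH by rewrite fa.
have a9 : arr y aG = arr s aG by rewrite fa.
rewrite -[k.+1]addn1 iotaD all_cat /= andbT add0n /upd /= h10 a10 a9 subn_gt0.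
case: leqP => hle /=; rewrite /upd /= ?h10 y7; split=> //; last by rewrite !andbF.
by rewrite hok andbT.
Qed.

Lemma mask_bodyP s :
  let S := var s xS in
  let K := var s xK in
  var s xone = 1 -> var s xzero = 0 -> (forall i, i < K -> arr s aP i = 2 ^ i) ->
  S < 2 ^ K ->
  let ok := mask_ok (var s xn) K (arr s aMn) (arr s aF) (arr s aU) (arr s aV) (arr s aW) S
    && ((S == 0) || has (fun i => bit S i && (0 < arr s aR (S - 2 ^ i))) (iota 0 K)) in
  let s' := eval mask_body s in
  [/\ var s' xok = ok, var s' xS = S.+1 & arr s' aR = upd (arr s aR) S ok].
Proof.
move=> S K h7 h17 hP hS ok s'.
pose s1 := eval copy_loop s.
pose c2 := (Add xT xS xzero ;; Add xi xK xzero ;; Const xok 1 ;;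
  If xS (Const xok 0) Skip)%cmd.
pose s2 := eval c2 s1.
pose s3 := eval (Loop xK bit_body) s2.
pose s4 := eval check_loop s3.
have es : s' = setv (seta s4 aR (var s4 xS) (var s4 xok)) xS
    (var s4 xS + var s4 xone) by [].
have fv1 x : x \notin wvars copy_loop -> var s1 x = var s x by apply: eval_frame_var.
have fa1 a : a \notin warrs copy_loop -> arr s1 a = arr s a by apply: eval_frame_arr.
have fv2 x : x \notin wvars c2 -> var s2 x = var s1 x by apply: eval_frame_var.
have fa2 a : arr s2 a = arr s1 a by apply: eval_frame_arr.
have fv3 x : x \notin wvars bit_body -> var s3 x = var s2 x.
  by move=> h; apply: eval_frame_var.
have fa3 a : a \notin warrs bit_body -> arr s3 a = arr s2 a.
  by move=> h; apply: eval_frame_arr.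
have fv4 x : x \notin wvars check_loop -> var s4 x = var s3 x by apply: eval_frame_var.
have fa4 a : arr s4 a = arr s3 a by apply: eval_frame_arr.
have s2_14 : var s2 xT = S.
  transitivity (var s1 xS + var s1 xzero); last by rewrite !fv1 // h17 addn0.
  by rewrite /s2 /= /upd /=; case: ifP.
have s2_5 : var s2 xi = K.
  transitivity (var s1 xK + var s1 xzero); last by rewrite !fv1 // h17 addn0.
  by rewrite /s2 /= /upd /=; case: ifP.
have s2_0 : var s2 xok = (S == 0).
  transitivity (nat_of_bool (var s1 xS == 0)); last by rewrite fv1.
  by rewrite /s2 /= /upd /= lt0n; case: eqP.
have s2_3 : var s2 xK = K by rewrite fv2 // fv1.
have s2_7 : var s2 xone = 1 by rewrite fv2 // fv1.
have s2_13 : var s2 xS = S by rewrite fv2 // fv1.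
have s2_P i : i < var s2 xK -> arr s2 aP i = 2 ^ i by rewrite s2_3 fa2 fa1 //; apply: hP.
have hS2 : S < 2 ^ var s2 xK by rewrite s2_3.
have [//|e0 eH eG] := bit_loopP s2_7 s2_P hS2 s2_13 s2_14 _ s2_0.
  by rewrite s2_5.
rewrite -/s3 s2_3 !fa2 (fa1 aR) // in e0.
have {}eH v : arr s3 aH v = arr s1 aH v +
    \sum_(0 <= i < K | bit S i && (arr s aV i == v)) arr s aW i.
  by rewrite eH s2_3 !fa2 (fa1 aV) // (fa1 aW).
have {}eG v : arr s3 aG v = arr s1 aG v +
    \sum_(0 <= i < K | bit S i && (arr s aU i == v)) arr s aW i.
  by rewrite eG s2_3 !fa2 (fa1 aU) // (fa1 aW).
have e4 : var s4 xok = ok.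
  rewrite /s4 (check_loopP _ e0); last by rewrite fv3 // fv2 // fv1.
  congr nat_of_bool; rewrite andbC; congr andb.
  rewrite fv3 // fv2 // fv1 //; apply: eq_in_all => v.
  rewrite mem_iota add0n => /= hv; rewrite eH eG.
  by have [-> ->] := copy_loopP h7 hv.
have e13 : var s4 xS = S by rewrite fv4 // fv3 // fv2 // fv1.
have e7 : var s4 xone = 1 by rewrite fv4 // fv3 // fv2 // fv1.
rewrite es e4 e13 e7 /=; split; rewrite /upd //= ?addn1 //.
by rewrite fa4 fa3 // fa2 fa1.
Qed.

(** Any [r] obeying the recurrence is what the table computes. [xok] keeps the entry of the mask
    treated last, so after [2 ^ K] rounds it is the entry of the full mask. *)
Lemma mask_loopP s (r : nat -> bool) :
  let K := var s xK in
  var s xone = 1 -> var s xzero = 0 -> (forall i, i < K -> arr s aP i = 2 ^ i) ->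
  var s xN <= 2 ^ K ->
  (forall S, S < 2 ^ K -> r S =
     mask_ok (var s xn) K (arr s aMn) (arr s aF) (arr s aU) (arr s aV) (arr s aW) S &&
     ((S == 0) || has (fun i => bit S i && r (S - 2 ^ i)) (iota 0 K))) ->
  var (eval mask_loop s) xok = (0 < var s xN) && r (var s xN - 1).
Proof.
move=> K h7 h17 hP hN hr.
have [] := @loop_inv (fun k y => [/\ var y xS = k,
    forall S, S < k -> arr y aR S = r S & var y xok = (0 < k) && r (k - 1)])
  xN mask_body (setv (setv s xok 0) xS 0) => //.
move=> k y hk [fv fa] [h13 hR _].
have {}fv x : x \notin wvars mask_body -> var y x = var s x.
  move=> h; rewrite fv //= /upd.
  case: eqP => [e|_]; first by rewrite e in h.
  by case: eqP => // e; rewrite e in h.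
have hkK : k < 2 ^ K by apply: leq_trans hN; move: hk; rewrite /= /upd.
have y7 : var y xone = 1 by rewrite fv.
have y17 : var y xzero = 0 by rewrite fv.
have yP i : i < var y xK -> arr y aP i = 2 ^ i by rewrite fv // fa //; apply: hP.
have yS : var y xS < 2 ^ var y xK by rewrite h13 fv.
have [] := mask_bodyP y7 y17 yP yS.
rewrite h13 (fv xK) // (fv xn) // (fa aMn) // (fa aF) // (fa aU) //.
rewrite (fa aV) // (fa aW) // => e0 e13 e11.
set ok := _ && _ in e0 e11.
have eok : ok = r k.
  rewrite hr // /ok; congr (_ && (_ || _)); apply: eq_in_has => i _.
  (* A set bit makes [k - 2 ^ i] smaller than [k], so that table entry has already been filled. *)
  case hb: (bit k i) => //=; rewrite hR; last first.
    have h2 : 0 < 2 ^ i by rewrite expn_gt0.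
    by have := bit_ge hb; lia.
  by case: (r _).
split=> //; last by rewrite e0 eok subn1.
move=> S; rewrite e11 /upd ltnS leq_eqVlt => /orP[/eqP->|hS].
  by rewrite eqxx eok.
by rewrite (ltn_eqF hS) hR.
Qed.

(** * Decoding the input *)

Lemma read_array_cat a x s l1 l2 :
  x != xi -> x != xt -> var s xone = 1 -> inp s = l1 ++ l2 -> size l1 = var s x ->
  let s' := eval (read_array a x) s in
  (forall j, j < size l1 -> arr s' a j = nth 0 l1 j) /\ inp s' = l2.
Proof.
move=> hx5 hx6 h7 hi hs; have [h1 h2] := read_arrayP a hx5 hx6 h7.
split=> [j hj|]; last by rewrite h2 hi -hs drop_size_cat.
by rewrite h1 -?hs // hi nth_cat hj.
Qed.

Definition read_instance : cmd :=
  (read_array aWt xnn ;; read_array aMn xn ;; read_array aC1 xnn ;; read_array aC2 xnn ;;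
   Read xl)%cmd.

Lemma read_instanceP s lW lM l1 l2 k :
  var s xone = 1 -> inp s = lW ++ lM ++ l1 ++ l2 ++ [:: k] ->
  size lW = var s xnn -> size lM = var s xn -> size l1 = var s xnn ->
  size l2 = var s xnn ->
  let s' := eval read_instance s in
  [/\ forall j, j < var s xnn -> arr s' aWt j = nth 0 lW j,
      forall j, j < var s xn -> arr s' aMn j = nth 0 lM j,
      forall j, j < var s xnn -> arr s' aC1 j = nth 0 l1 j,
      forall j, j < var s xnn -> arr s' aC2 j = nth 0 l2 j & var s' xl = k].
Proof.
move=> h7 hi eW eM e1 e2 s'.
pose s1 := eval (read_array aWt xnn) s; pose s2 := eval (read_array aMn xn) s1.
pose s3 := eval (read_array aC1 xnn) s2; pose s4 := eval (read_array aC2 xnn) s3.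
have es : s' = eval (Read xl) s4 by [].
have fv1 x : x \notin [:: xi; xt] -> var s1 x = var s x.
  by move=> h; apply: eval_frame_var; move: h; rewrite !inE !negb_or => /andP[-> ->].
have fv2 x : x \notin [:: xi; xt] -> var s2 x = var s x.
  move=> h; rewrite -fv1 //; apply: eval_frame_var.
  by move: h; rewrite !inE !negb_or => /andP[-> ->].
have fv3 x : x \notin [:: xi; xt] -> var s3 x = var s x.
  move=> h; rewrite -fv2 //; apply: eval_frame_var.
  by move: h; rewrite !inE !negb_or => /andP[-> ->].
have [] := @read_array_cat aWt xnn s _ _ isT isT h7 hi eW; rewrite -/s1 => aW i1.
have [||aM i2] := @read_array_cat aMn xn s1 _ _ isT isT _ i1; rewrite ?fv1 //.
have [||a1 i3] := @read_array_cat aC1 xnn s2 _ _ isT isT _ i2; rewrite ?fv2 //.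
have [||a2 i4] := @read_array_cat aC2 xnn s3 _ _ isT isT _ i3; rewrite ?fv3 //.
rewrite -/s2 in aM; rewrite -/s3 in a1; rewrite -/s4 in a2 i4.
rewrite es; split=> [j hj|j hj|j hj|j hj|] /=.
- rewrite /s4 eval_frame_arr // /s3 eval_frame_arr // /s2 eval_frame_arr //.
  by apply: aW; rewrite eW.
- by rewrite /s4 eval_frame_arr // /s3 eval_frame_arr //; apply: aM; rewrite eM.
- by rewrite /s4 eval_frame_arr //; apply: a1; rewrite e1.
- by apply: a2; rewrite e2.
by rewrite /upd /= i4.
Qed.

Lemma nth_allpairs (S T R : Type) (f : S -> T -> R) (xs : seq S) (ys : seq T)
    x0 y0 z0 i j :
  i < size xs -> j < size ys ->
  nth z0 [seq f x y | x <- xs, y <- ys] (i * size ys + j) = f (nth x0 xs i) (nth y0 ys j).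
Proof.
elim: xs i => //= x xs IH [|i] hi hj; rewrite nth_cat size_map.
  by rewrite mul0n add0n hj (nth_map y0).
rewrite mulSn -addnA ltnNge leq_addr /= addKn; exact: IH.
Qed.

Lemma size_matrix_enc n (A : 'I_n -> 'I_n -> nat) : size (matrix_enc A) = n * n.
Proof. by rewrite size_allpairs -cardE card_ord. Qed.

Lemma nth_matrix_enc n (A : 'I_n -> 'I_n -> nat) (u v : 'I_n) :
  nth 0 (matrix_enc A) (u * n + v) = A u v.
Proof.
have sz : size (enum 'I_n) = n by rewrite -cardE card_ord.
have := @nth_allpairs _ _ _ A (enum 'I_n) (enum 'I_n) u u 0 u v.
by rewrite sz !nth_ord_enum; apply; rewrite ltn_ord.
Qed.

Definition cells n : seq ('I_n * 'I_n) := [seq (u, v) | u <- enum 'I_n, v <- enum 'I_n].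

Lemma cells_uniq n : uniq (cells n).
Proof. by apply: allpairs_uniq; rewrite ?enum_uniq // => -[a b] [c d] _ _ [-> ->]. Qed.

Lemma mem_cells n d : d \in cells n.
Proof. by case: d => u v; apply: allpairs_f; rewrite mem_enum. Qed.

Lemma size_cells n : size (cells n) = n * n.
Proof. by rewrite size_allpairs -cardE card_ord. Qed.

Lemma map_cells n : map (@nat2 n) (cells n) = [seq (u, v) | u <- iota 0 n, v <- iota 0 n].
Proof. by rewrite /cells map_allpairs -val_enum_ord allpairs_mapl allpairs_mapr. Qed.

Lemma ltn_cell n (d : 'I_n * 'I_n) : d.1 * n + d.2 < n * n.
Proof. by have := ltn_ord d.1; have := ltn_ord d.2; nia. Qed.

Lemma eq_mask_ok n K mn F U V W mn' F' U' V' W' S :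
  (forall v, v < n -> mn v = mn' v) -> (forall v, v < n -> F v = F' v) ->
  (forall i, i < K -> [/\ U i = U' i, V i = V' i & W i = W' i]) ->
  mask_ok n K mn F U V W S = mask_ok n K mn' F' U' V' W' S.
Proof.
move=> hm hF h; apply: eq_in_all => v; rewrite mem_iota add0n => /= hv.
rewrite hm // hF //; congr (_ + _ <= _ + _);
  rewrite big_nat_cond [RHS]big_nat_cond; apply: eq_big => i.
- by case: (ltnP i K) => //= /h[_ -> _].
- by move=> /andP[/andP[_ /h[]]].
- by case: (ltnP i K) => //= /h[-> _ _].
- by move=> /andP[/andP[_ /h[]]].
Qed.

Definition prepare : cmd :=
  ((Const xone 1 ;; Read xn) ;; square ;; read_instance ;; collect)%cmd.

Definition solver : cmd := (prepare ;; powers ;; mask_count ;; mask_loop)%cmd.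

(** The arcs of D in row-major order, the order in which [collect] meets them, so that bit [i] of a
    mask refers to entry [i]. *)
Definition diff_list (x : ncl_instance) :=
  [seq d <- cells (nv (ncl_graph x)) | (d \in ncl_start x) && (d \notin ncl_target x)].

Lemma prepareP (x : ncl_instance) :
  let G := ncl_graph x in
  let s := eval prepare (start_store (ncl_enc x)) in
  let dl := diff_list x in
  exists w, [/\
     [/\ var s xn = nv G, var s xK = size dl, var s xone = 1,
      var s xl = ncl_length x & var s xzero = 0],
      forall v : 'I_(nv G), arr s aMn v = min_inflow v,
      forall v : 'I_(nv G), arr s aF v = inflow (ncl_start x) v,
      forall d, d \in ncl_start x -> w (nat2 d) = weight d.1 d.2
    & forall i, i < size dl -> let d := nth (0, 0) (map (@nat2 _) dl) i in
        [/\ arr s aU i = d.1, arr s aV i = d.2 & arr s aW i = w d]].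
Proof.
move=> G s dl; set n := nv G; set C1 := ncl_start x; set C2 := ncl_target x.
pose s1 := eval (Const xone 1 ;; Read xn)%cmd (start_store (ncl_enc x)).
pose s2 := eval square s1.
pose s3 := eval read_instance s2.
have es : s = eval collect s3 by [].
have s2_1 : var s2 xn = n by rewrite /s2 eval_frame_var.
have s2_2 : var s2 xnn = n * n by rewrite /s2 squareP.
have s2_7 : var s2 xone = 1 by rewrite /s2 eval_frame_var.
have s2_i : inp s2 = behead (ncl_enc x) by rewrite /s2 eval_inp.
have [] := read_instanceP s2_7 s2_i; rewrite ?s2_1 ?s2_2 ?size_matrix_enc //.
  by rewrite size_map -cardE card_ord.
rewrite -/s3 => aW aM a1 a2 s3_8.
have s3_1 : var s3 xn = n by rewrite /s3 eval_frame_var.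
have s3_2 : var s3 xnn = n * n by rewrite /s3 eval_frame_var.
have s3_7 : var s3 xone = 1 by rewrite /s3 eval_frame_var.
have s3_F : arr s3 aF =1 (fun _ => 0).
  by move=> v; rewrite /s3 eval_frame_arr // /s2 eval_frame_arr.
have W1 (d : 'I_n * 'I_n) : arr s3 aWt (d.1 * n + d.2) =
    if adj d.1 d.2 then weight d.1 d.2 else 0.
  by rewrite aW ?ltn_cell // nth_matrix_enc.
have C1E (d : 'I_n * 'I_n) : arr s3 aC1 (d.1 * n + d.2) = (d \in C1).
  by rewrite a1 ?ltn_cell // nth_matrix_enc; case: d.
have C2E (d : 'I_n * 'I_n) : arr s3 aC2 (d.1 * n + d.2) = (d \in C2).
  by rewrite a2 ?ltn_cell // nth_matrix_enc; case: d.
have [] := collectP s3_7 s3_F; rewrite -es s3_1 -map_cells => _ hF hK hd.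
have edl : [seq d <- map (@nat2 n) (cells n) | (0 < arr s3 aC1 (d.1 * n + d.2)) &&
     (arr s3 aC2 (d.1 * n + d.2) == 0)] = map (@nat2 n) dl.
  rewrite filter_map; congr map; apply: eq_filter => d /=.
  by rewrite C1E C2E; case: (d \in C1); case: (d \in C2).
rewrite edl in hK hd; rewrite size_map in hK hd.
(* The encoding replaces weights of non-edges by 0, but the arcs of a configuration are edges. *)
have hw d : d \in C1 -> arr s3 aWt (d.1 * n + d.2) = weight d.1 d.2.
  move=> hd1; rewrite W1; have [[h _] _] := ncl_start_legal x.
  by rewrite h //; case: d hd1.
exists (fun d => arr s3 aWt (d.1 * n + d.2)); split.
- split=> //; rewrite es eval_frame_var //.
  by rewrite /s3 eval_frame_var // /s2 eval_frame_var.
- move=> v; rewrite es eval_frame_arr // aM // (nth_map v) ?nth_ord_enum //.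
  by rewrite -cardE card_ord.
- move=> v; rewrite hF big_map inflow_arcs big_mkcond big_uniq ?cells_uniq //=.
  rewrite -big_mkcondr /=; apply: eq_big => d.
    by rewrite mem_cells C1E lt0b.
  by rewrite mem_cells C1E lt0b /= => /andP[/hw].
- by move=> d /hw.
by move=> i hi; apply: hd.
Qed.

(** [b] stands for the truth value of [ncl_yes x]; the two halves of [decides_within] are the cases
    [true] and [false]. *)
Lemma solverP (x : ncl_instance) (b : bool) :
  (ncl_yes x <-> b) -> var (eval solver (start_store (ncl_enc x))) xok = b.
Proof.
rewrite /solver 3!eval_seq.
have [w [[s1 s3 s7 s8 s17] hM hF hw hd]] := prepareP x.
set G := ncl_graph x in s1 hM hF hw hd; set dl := diff_list x in s3 hd.
set s := eval prepare _ in s1 s3 s7 s8 s17 hM hF hd *.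
clearbody s; pose t := eval powers s; pose r := eval mask_count t.
have lC := ncl_start_legal x.
have udl : uniq dl by rewrite filter_uniq ?cells_uniq.
have sdl : {subset dl <= ncl_start x} by move=> d; rewrite mem_filter => /andP[/andP[]].
have [tP t12] := powersP s7.
have rv z : z \notin wvars mask_count -> z \notin wvars powers ->
    var r z = var s z.
  by move=> h1 h2; rewrite /r eval_frame_var // /t eval_frame_var.
have ra z : z \notin warrs mask_count -> z \notin warrs powers ->
    arr r z = arr s z.
  by move=> h1 h2; rewrite /r eval_frame_arr // /t eval_frame_arr.
have r4 : var r xN = if size dl <= ncl_length x then 2 ^ size dl else 0.
  rewrite /r mask_countP ?t12 /t ?eval_frame_var //.
  by rewrite s3 s8.
have := @mask_loopP r (mask_reachable (ncl_start x) dl).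
rewrite (rv xone) // (rv xzero) // (rv xK) // (rv xn) // s1 s3 => /(_ s7 s17) H.
have {H} : var (eval mask_loop r) xok =
    (0 < var r xN) && mask_reachable (ncl_start x) dl (var r xN - 1).
  apply: H.
  - move=> i hi; rewrite /r eval_frame_arr //; apply: tP; by rewrite s3.
  - by rewrite r4; case: ifP.
  move=> S hS; rewrite mask_reachableE //; congr (_ && _).
  rewrite (@mask_okE G _ _ _ (arr s aMn) (arr s aF) w) //; last by case: lC.
  by apply: eq_mask_ok => // [v|v|i hi]; rewrite !ra //; have [-> -> ->] := hd _ hi.
rewrite -/t -/r.
move=> -> hb; congr nat_of_bool.
have eD : [set d in dl] = ncl_start x :\: ncl_target x.
  by apply/setP=> d; rewrite !inE mem_filter mem_cells andbT andbC.
have cD : #|ncl_start x :\: ncl_target x| = size dl.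
  by rewrite -eD cardsE; apply/card_uniqP.
(* The last mask [2 ^ K - 1] selects all of D; for [K > l] no mask is treated and both sides are
   false. *)
apply/idP/idP => [h|/hb /ncl_yesE].
  apply/hb/ncl_yesE; rewrite cD; move: h; rewrite r4.
  case: ifP => // hl; rewrite expn_gt0 /= andbT.
  by rewrite /mask_reachable maskset_full eD cD.
rewrite cD r4 => /andP[h ->].
by rewrite expn_gt0 /= /mask_reachable maskset_full eD cD.
Qed.

(** * Running time *)

Lemma prepare_time l :
  time prepare (start_store l) <= 200 * (head 0 l * head 0 l + head 0 l + 1).
Proof.
set n := head 0 l; rewrite /prepare (time_seq (_ ;; _)%cmd).
rewrite (time_seq square) (time_seq read_instance).
pose s1 := eval (Const xone 1 ;; Read xn)%cmd (start_store l).
rewrite -/s1; pose s2 := eval square s1; rewrite -/s2.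
pose s3 := eval read_instance s2; rewrite -/s3.
have e21 : var s2 xn = n by rewrite /s2 eval_frame_var.
have e22 : var s2 xnn = n * n by rewrite /s2 squareP.
have e31 : var s3 xn = n by rewrite /s3 eval_frame_var.
have e11 : var s1 xn = n by [].
have e0 : time (Const xone 1 ;; Read xn)%cmd (start_store l) = 2 by [].
rewrite {}e0; move: s1 s2 s3 e11 e21 e22 e31 => s1 s2 s3 e11 e21 e22 e31.
have := @time_le_bound square s1 isT; move: (time _ s1) => T1.
have := @time_le_bound read_instance s2 isT; move: (time _ s2) => T2.
have := @time_le_bound collect s3 isT; move: (time _ s3) => T3.
rewrite /= e11 e21 e22 e31 => t3 t2 t1.
lia.
Qed.

Lemma solver_time (x : ncl_instance) :
  time solver (start_store (ncl_enc x)) <=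
  1000 * 2 ^ ncl_length x * @input_size bounded_C2C_NCL x ^ 2.
Proof.
have [w [[s1 s3 s7 s8 s17] _ _ _ _]] := prepareP x.
have := prepare_time (ncl_enc x); rewrite /solver (time_seq prepare).
rewrite (time_seq powers) (time_seq mask_count) [head _ _]/=.
set sz := input_size _; set n := nv (ncl_graph x) in s1 *.
(* Every encoded number takes at least one bit, and the encoding has exactly this many: three
   matrices, the minimum inflows, [n] and [l]. *)
have hsz : 3 * (n * n) + n + 2 <= sz.
  have : size (ncl_enc x) <= sz.
    by rewrite /sz /input_size -sum1_size; apply: leq_sum.
  rewrite /ncl_enc /= !size_cat /config_enc !size_matrix_enc size_map -cardE card_ord /=.
  by rewrite -/n; lia.
set T := time prepare _; set s := eval prepare _ in s1 s3 s7 s8 s17 *.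
clearbody s T => hT.
set K := size _ in s3.
have hK : K <= n * n.
  by rewrite /K size_filter -size_cells; apply: count_size.
set t := eval powers s; set r := eval mask_count t.
have r1 : var r xn = n by rewrite /r eval_frame_var // /t eval_frame_var.
have r3 : var r xK = K by rewrite /r eval_frame_var // /t eval_frame_var.
have r4 : var r xN <= 2 ^ ncl_length x.
  have [_ t12] := powersP s7.
  rewrite /r mask_countP ?t12 /t ?eval_frame_var //.
  by rewrite s3 s8; case: ifP => // h; rewrite leq_exp2l.
have := @time_le_bound powers s isT; move: (time _ s) => T4.
have := @time_le_bound mask_count t isT; move: (time _ t) => T5.
have := @time_le_bound mask_loop r isT; move: (time _ r) => T6.
clearbody r t.
rewrite /= s3 r1 r3 => t6 t5 t4.
set N := var r xN in r4 t6; set L := 2 ^ ncl_length x in r4 *.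
have hL : 0 < L by rewrite expn_gt0.
(* Each monomial in the time bounds has a factor at most [L] and a factor at most [sz], hence is at
   most [Q]. The constant 1000 only has to exceed the sum of the coefficients: 600 from [prepare],
   less than 200 from the mask loop, and a few from the rest. *)
pose Q := L * sz ^ 2.
have hQ a b : a <= L -> b <= sz -> a * b <= Q.
  move=> ha hb; apply: leq_mul => //; apply: leq_trans hb _.
  by rewrite -[X in X <= _]expn1 leq_pexp2l //; lia.
have q1 : 1 * 1 <= Q by apply: hQ; lia.
have q2 : 1 * (n * n) <= Q by apply: hQ; lia.
have q3 : 1 * n <= Q by apply: hQ; lia.
have q4 : N * n <= Q by apply: hQ; lia.
have q5 : N * K <= Q by apply: hQ; lia.
have q6 : N * 1 <= Q by apply: hQ; lia.
rewrite -mulnA -/Q; clearbody N Q K n.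
clear -hT hK q1 q2 q3 q4 q5 q6 t4 t5 t6.
lia.
Qed.

(** Tractability also asks for a computable bound: [powers], run with [l] as its count, leaves
    [2 ^ l] in [xp]. *)
Definition power_program : cmd :=
  (Const xone 1 ;; Read xK ;; powers ;; Add xok xp xzero)%cmd.

Lemma exp2_computable : computable (fun l => 2 ^ l).
Proof.
exists (compile power_program 0 0) => l; eexists.
pose s := eval (Const xone 1 ;; Read xK)%cmd (start_store [:: l]).
have -> : 2 ^ l = var (eval power_program (start_store [:: l])) xok.
  transitivity (var (eval powers s) xp + var (eval powers s) xzero); last by [].
  by have [//|_ ->] := @powersP s; rewrite eval_frame_var // addn0.
exact: compile_outputs.
Qed.

Lemma solver_solves : solvable_in_Ostar bounded_C2C_NCL (fun l => 2 ^ l).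
Proof.
exists (compile solver 0 0), 1000, 2 => x.
have := @compile_outputs solver (ncl_enc x) _ isT (solver_time x).
by move=> h; split=> hx;
  [rewrite (@solverP x true) in h | rewrite (@solverP x false) in h].
Qed.

Theorem theorem14 :
  fixed_parameter_tractable bounded_C2C_NCL /\
  solvable_in_Ostar bounded_C2C_NCL (fun l : nat => 2 ^ l).
Proof.
split; last exact: solver_solves.
by exists (fun l => 2 ^ l); [exact: exp2_computable | exact: solver_solves].
Qed.
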